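(* If $X\subseteq\omega$ is not arithmetical, then there is a Turing degree which is high for tight descending sequences and does not compute $X$.
   Context: For a linear order $\mathcal L$, a tight descending sequence is an infinite descending sequence $f$ which is unbounded below in the ill-founded part of $\mathcal L$: for every descending sequence $g$ in $\mathcal L$ and every $n$ there is $m$ with $f(m)<_{\mathcal L}g(n)$. A degree $\mathbf d$ is high for tight descending sequences if every computable ill-founded linear order has a $\mathbf d$-computable tight descending sequence. *)

(* Defs.v *)
From mathcomp Require Import all_boot.
From mathcomp Require Import boolp classical_sets.

Set Implicit Arguments.
Unset Strict Implicit.
Unset Printing Implicit Defensive.

Local Open Scope classical_set_scope.

(* Kleene's schemes for the partial recursive functions with an oracle. Codes  *)
(* are untyped: a code denotes a partial function on argument lists, which is  *)
(* only ever used at a fixed arity; missing arguments are read as 0.           *)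
Inductive code : Type :=
| Zero
| Succ
| Proj of nat
| Query
| Comp of code & seq code
| Prec of code & code
| Mu of code.

(* [eval O c v y]: with oracle O, the computation of c on v halts with value y *)
Inductive eval (O : nat -> nat) : code -> seq nat -> nat -> Prop :=
| eval_zero v : eval O Zero v 0
| eval_succ v : eval O Succ v (nth 0 v 0).+1
| eval_proj i v : eval O (Proj i) v (nth 0 v i)
| eval_query v : eval O Query v (O (nth 0 v 0))
| eval_comp f gs v ws y :
    size ws = size gs ->
    (forall i, i < size gs -> eval O (nth Zero gs i) v (nth 0 ws i)) ->
    eval O f ws y ->
    eval O (Comp f gs) v y
| eval_prec0 f g v y :
    eval O f v y -> eval O (Prec f g) (0 :: v) y
| eval_precS f g n v z y :
    eval O (Prec f g) (n :: v) z ->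
    eval O g [:: n, z & v] y ->
    eval O (Prec f g) (n.+1 :: v) y
| eval_mu f v n (w : nat -> nat) :
    (forall m, m < n -> eval O f (m :: v) (w m).+1) ->
    eval O f (n :: v) 0 ->
    eval O (Mu f) v n.

Definition chi (A : set nat) (x : nat) : nat := `[< A x >].

Definition fun_computable_in (A : set nat) (f : nat -> nat) : Prop :=
  exists c, forall x, eval (chi A) c [:: x] (f x).

Definition rel_computable_in (A : set nat) (k : nat) (P : seq nat -> Prop) : Prop :=
  exists c, forall v, size v = k -> eval (chi A) c v `[< P v >].

Definition turing_le (B A : set nat) : Prop := fun_computable_in A (chi B).

Definition turing_equiv (B A : set nat) : Prop := turing_le B A /\ turing_le A B.

Record turing_degree : Type := TuringDegree {
  degree_sets : set (set nat);
  degree_class : exists A, forall B, degree_sets B <-> turing_equiv B A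
}.

Definition degree_computes_fun (d : turing_degree) (f : nat -> nat) : Prop :=
  exists2 A, degree_sets d A & fun_computable_in A f.

Definition degree_computes_set (d : turing_degree) (X : set nat) : Prop :=
  exists2 A, degree_sets d A & turing_le X A.

(* Q y_1 Q' y_2 Q y_3 ... P (x, y_1, ..., y_n), with n alternating quantifiers *)
(* of which the first one is existential iff ex is true.                       *)
Fixpoint alternating (ex : bool) (n : nat) (P : seq nat -> Prop) (v : seq nat) : Prop :=
  if n is m.+1 then
    if ex then exists y, alternating false m P (rcons v y)
    else forall y, alternating true m P (rcons v y)
  else P v.

Definition in_hierarchy (ex : bool) (n : nat) (X : set nat) : Prop :=
  exists2 P, rel_computable_in set0 n.+1 P &
    forall x, X x <-> alternating ex n P [:: x].

Definition Sigma0 := in_hierarchy true.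
Definition Pi0 := in_hierarchy false.

Definition arithmetical (X : set nat) : Prop :=
  exists n, Sigma0 n X \/ Pi0 n X.

Record linear_order : Type := LinearOrder {
  lo_dom : set nat;
  lo_lt : nat -> nat -> Prop;
  lo_lt_dom : forall x y, lo_lt x y -> lo_dom x /\ lo_dom y;
  lo_lt_irrefl : forall x, ~ lo_lt x x;
  lo_lt_trans : forall x y z, lo_lt x y -> lo_lt y z -> lo_lt x z;
  lo_lt_total : forall x y, lo_dom x -> lo_dom y -> [\/ lo_lt x y, x = y | lo_lt y x]
}.

Definition computable_order (L : linear_order) : Prop :=
  rel_computable_in set0 1 (fun v => lo_dom L (nth 0 v 0)) /\
  rel_computable_in set0 2 (fun v => lo_lt L (nth 0 v 0) (nth 0 v 1)).

Definition descending (L : linear_order) (f : nat -> nat) : Prop :=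
  forall n, lo_lt L (f n.+1) (f n).

Definition ill_founded (L : linear_order) : Prop := exists f, descending L f.

Definition tight_descending (L : linear_order) (f : nat -> nat) : Prop :=
  descending L f /\
  forall g, descending L g -> forall n, exists m, lo_lt L (f m) (g n).

Definition high_for_tight_descending (d : turing_degree) : Prop :=
  forall L, computable_order L -> ill_founded L ->
    exists2 f, tight_descending L f & degree_computes_fun d f.

(* Main.v *)
From HB Require Import structures.
Require Import Defs.
From mathcomp Require Import all_boot.
From mathcomp Require Import boolp classical_sets.

(* The degree is that of a set [D] built by finite approximations, whose i-th   *)
(* column is, up to finitely many elements, a coinitial subset of the           *)
(* ill-founded part I_i of the i-th computable order; such a column computes a  *)
(* tight descending sequence. To keep a given code from computing [X] out of    *)
(* the extensions of an approximation [p], consider tuples v of points, one for *)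
(* each column whose I_i is not arithmetical, and relax the constraint "in I_i" *)
(* of [p] to "above v_i". If some v in the well-founded parts makes a correct   *)
(* answer impossible, [p] is good already; if some v in the I_i makes a wrong   *)
(* answer possible, [p] has an extension forcing it. Otherwise, let A be the    *)
(* set of the v for which all possible answers are consistent. Then A contains  *)
(* all tuples from the I_i, where only correct answers arise, and no tuple from *)
(* the well-founded parts, where all correct answers arise: a consistent such   *)
(* tuple would make [X] arithmetical. A compactness argument shows that such an *)
(* arithmetical A exists only if some I_i is arithmetical, a contradiction.     *)

Set Implicit Arguments.
Unset Strict Implicit.
Unset Printing Implicit Defensive.

Local Open Scope classical_set_scope.

(** * Oracle computations *)

Lemma code_nested_ind (P : code -> Prop) :
  P Zero -> P Succ -> (forall i, P (Proj i)) -> P Query ->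
  (forall f gs, P f -> (forall i, i < size gs -> P (nth Zero gs i)) ->
    P (Comp f gs)) ->
  (forall f g, P f -> P g -> P (Prec f g)) ->
  (forall f, P f -> P (Mu f)) -> forall c, P c.
Proof.
move=> P_zero P_succ P_proj P_query P_comp P_prec P_mu.
fix IH 1 => -[||i||f gs|f g|f].
- exact: P_zero.
- exact: P_succ.
- exact: P_proj.
- exact: P_query.
- apply: P_comp; first exact: IH.
  move: gs; fix IHs 1 => -[|g gs] [|i] lt_i;
    [by case: (notF lt_i) | by case: (notF lt_i) | exact: (IH g) |].
  exact: (IHs gs i lt_i).
- by apply: P_prec; exact: IH.
- by apply: P_mu; exact: IH.
Qed.

Fixpoint tree_of_code (c : code) : GenTree.tree nat :=
  match c with
  | Zero => GenTree.Leaf 0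
  | Succ => GenTree.Leaf 1
  | Query => GenTree.Leaf 2
  | Proj i => GenTree.Node i [::]
  | Comp f gs => GenTree.Node 0 (tree_of_code f :: map tree_of_code gs)
  | Prec f g => GenTree.Node 1 [:: tree_of_code f; tree_of_code g]
  | Mu f => GenTree.Node 2 [:: tree_of_code f]
  end.

Fixpoint code_of_tree (t : GenTree.tree nat) : code :=
  match t with
  | GenTree.Leaf 0 => Zero
  | GenTree.Leaf 1 => Succ
  | GenTree.Leaf _ => Query
  | GenTree.Node i [::] => Proj i
  | GenTree.Node 0 (f :: gs) => Comp (code_of_tree f) (map code_of_tree gs)
  | GenTree.Node 1 [:: f; g] => Prec (code_of_tree f) (code_of_tree g)
  | GenTree.Node _ (f :: _) => Mu (code_of_tree f)
  end.

Lemma tree_of_codeK : cancel tree_of_code code_of_tree.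
Proof.
elim/code_nested_ind => [||[|[|[|i]]]||f gs IHf IHgs|f g IHf IHg|f IHf] //=.
- rewrite IHf -map_comp; congr Comp.
  apply: (@eq_from_nth _ Zero); rewrite size_map // => i lt_i.
  by rewrite (nth_map Zero) //; exact: IHgs.
- by rewrite IHf IHg.
- by rewrite IHf.
Qed.

HB.instance Definition _ := Countable.copy code (can_type tree_of_codeK).

Section EvalInversion.
Variable O : nat -> nat.
Implicit Types (c f g : code) (gs : seq code) (v : seq nat).

Lemma eval_compP f gs v y : eval O (Comp f gs) v y <->
  exists ws, [/\ size ws = size gs,
    forall i, i < size gs -> eval O (nth Zero gs i) v (nth 0 ws i) &
    eval O f ws y].
Proof.
split=> [eval_y|[ws [sz_ws eval_gs eval_f]]]; last exact: eval_comp eval_f.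
by inversion eval_y; subst; exists ws.
Qed.

Lemma eval_prec_nil f g y : ~ eval O (Prec f g) [::] y.
Proof. by move=> eval_y; inversion eval_y. Qed.

Lemma eval_prec0P f g v y : eval O (Prec f g) (0 :: v) y <-> eval O f v y.
Proof. by split=> [eval_y|]; [inversion eval_y | exact: eval_prec0]. Qed.

Lemma eval_precSP f g n v y : eval O (Prec f g) (n.+1 :: v) y <->
  exists2 z, eval O (Prec f g) (n :: v) z & eval O g [:: n, z & v] y.
Proof.
split=> [eval_y|[z]]; last exact: eval_precS.
by inversion eval_y; subst; exists z.
Qed.

Lemma eval_muP f v n : eval O (Mu f) v n <->
  (forall m, m < n -> exists w, eval O f (m :: v) w.+1) /\ eval O f (n :: v) 0.
Proof.
split=> [eval_n|[eval_pos eval0]].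
  inversion eval_n as [| | | | | | |f' v' n' w eval_pos eval0]; subst.
  by split=> // m /eval_pos eval_w; exists (w m).
have /choice [w eval_w] m : exists w, m < n -> eval O f (m :: v) w.+1.
  by have [/eval_pos [w]|] := boolP (m < n); [exists w | exists 0].
exact: eval_mu eval_w eval0.
Qed.

Lemma eval_deterministic c v y z : eval O c v y -> eval O c v z -> y = z.
Proof.
move=> eval_y; elim: eval_y z => {c v y}.
- by move=> v z eval_z; inversion eval_z.
- by move=> v z eval_z; inversion eval_z.
- by move=> i v z eval_z; inversion eval_z.
- by move=> v z eval_z; inversion eval_z.
- move=> f gs v ws y sz_ws _ IHg _ IHf z /eval_compP [ws' [sz_ws' eval_gs eval_f]].
  apply: IHf; suff -> : ws = ws' by [].
  apply: (@eq_from_nth _ 0); first by rewrite sz_ws sz_ws'.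
  by move=> i; rewrite sz_ws => lt_i; exact: IHg (eval_gs _ lt_i).
- by move=> f g v y _ IH z /eval_prec0P/IH.
- by move=> f g n v z y _ IHn _ IHy z' /eval_precSP [z1 /IHn <- /IHy].
- move=> f v n w _ IHpos _ IH0 z /eval_muP [eval_pos eval0].
  case: (ltngtP n z) => // lt_nz.
    by have [w' /IH0] := eval_pos _ lt_nz.
  by have := IHpos _ lt_nz _ eval0.
Qed.

End EvalInversion.

Definition agree (n : nat) (A B : set nat) : Prop := forall a, a < n -> (A a <-> B a).

Lemma agreeW m n A B : m <= n -> agree n A B -> agree m A B.
Proof. by move=> le_mn eAB a lt_a; apply: eAB; exact: leq_trans le_mn. Qed.

Lemma agree_sym n A B : agree n A B -> agree n B A.
Proof. by move=> eAB a /eAB ->. Qed.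

Lemma agree_trans n A B C : agree n A B -> agree n B C -> agree n A C.
Proof. by move=> eAB eBC a lt_a; rewrite (eAB a lt_a); exact: eBC. Qed.

Lemma agreeS n A B : agree n A B -> (A n <-> B n) -> agree n.+1 A B.
Proof. by move=> eAB en a; rewrite ltnS leq_eqVlt => /orP[/eqP -> //|]; exact: eAB. Qed.

Lemma agree_setI_ltn m n A : m <= n -> agree m (A `&` `I_n) A.
Proof.
by move=> le_mn a lt_a; split=> [[]|Aa] //; split=> //; exact: leq_trans lt_a le_mn.
Qed.

Lemma uniform_bound k (P : nat -> nat -> Prop) :
  (forall i m n, m <= n -> P i m -> P i n) ->
  (forall i, i < k -> exists n, P i n) -> exists n, forall i, i < k -> P i n.
Proof.
move=> P_mono exP.
have /fin_all_exists [u Pu] : forall i : 'I_k, exists n, P i n by move=> i; exact: exP.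
exists (\max_i u i) => i lt_i; apply: P_mono (Pu (Ordinal lt_i)); exact: leq_bigmax.
Qed.

Lemma eval_use (A : set nat) c v y : eval (chi A) c v y ->
  exists N, forall B, agree N B A -> eval (chi B) c v y.
Proof.
have agree_max N M B : agree (maxn N M) B A -> agree N B A /\ agree M B A.
  by move=> e; split; [apply: agreeW (leq_maxl N M) e | apply: agreeW (leq_maxr N M) e].
elim=> {c v y}.
- by move=> v; exists 0 => *; constructor.
- by move=> v; exists 0 => *; constructor.
- by move=> i v; exists 0 => *; constructor.
- move=> v; exists (nth 0 v 0).+1 => B /(_ _ (ltnSn _)) /asbool_equiv_eq e.
  by rewrite /chi -e; exact: eval_query.
- move=> f gs v ws y sz_ws _ IHg _ [N evalN].
  have [|M evalM] := uniform_bound (k := size gs) (P := fun i M =>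
      forall B, agree M B A -> eval (chi B) (nth Zero gs i) v (nth 0 ws i)) _ IHg.
    by move=> i m n le_mn evalm B e; apply/evalm/(agreeW le_mn).
  exists (maxn N M) => B /agree_max[eN eM]; apply: (eval_comp sz_ws); last exact: evalN.
  by move=> i lt_i; exact: evalM.
- by move=> f g v y _ [N evalN]; exists N => B /evalN; exact: eval_prec0.
- move=> f g n v z y _ [N evalN] _ [M evalM]; exists (maxn N M) => B /agree_max[eN eM].
  by apply: eval_precS; [exact: evalN | exact: evalM].
- move=> f v n w _ IH _ [N evalN].
  have [|M evalM] := uniform_bound (k := n) (P := fun m M =>
      forall B, agree M B A -> eval (chi B) f (m :: v) (w m).+1) _ IH.
    by move=> i m n' le_mn evalm B e; apply/evalm/(agreeW le_mn).
  exists (maxn N M) => B /agree_max[eN eM].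
  apply: (@eval_mu _ _ _ _ w); last exact: evalN.
  by move=> m lt_m; exact: evalM.
Qed.

Fixpoint subst_query (q c : code) : code :=
  match c with
  | Query => Comp q [:: Proj 0]
  | Comp f gs => Comp (subst_query q f) (map (subst_query q) gs)
  | Prec f g => Prec (subst_query q f) (subst_query q g)
  | Mu f => Mu (subst_query q f)
  | c => c
  end.

Lemma eval_subst_query O O' q c v y :
  (forall x, eval O' q [:: x] (O x)) -> eval O c v y ->
  eval O' (subst_query q c) v y.
Proof.
move=> eval_q; elim=> {c v y} /=; try by move=> *; constructor.
- move=> v; apply: (@eval_comp _ _ _ _ [:: nth 0 v 0]) => //.
  by case=> // _; exact: eval_proj.
- move=> f gs v ws y sz_ws _ IHg _ IHf; apply: (@eval_comp _ _ _ _ ws) => //.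
    by rewrite size_map.
  by move=> i; rewrite size_map => lt_i; rewrite (nth_map Zero) //; exact: IHg.
- by move=> *; apply: eval_precS; eassumption.
- by move=> *; apply: eval_mu; eassumption.
Qed.

Definition computes O k (f : seq nat -> nat) : Prop :=
  exists c, forall v, size v = k -> eval O c v (f v).

Lemma eq_computes O k f g :
  (forall v, size v = k -> f v = g v) -> computes O k f -> computes O k g.
Proof. by move=> e [c eval_c]; exists c => v sz_v; rewrite -e //; exact: eval_c. Qed.

Lemma fun_computableP A f :
  fun_computable_in A f <-> computes (chi A) 1 (fun v => f (nth 0 v 0)).
Proof.
split=> -[c eval_c]; exists c; first by case=> [|x []] // _; exact: eval_c.
by move=> x; exact: (eval_c [:: x]).
Qed.

Lemma computes_trans A B k f :
  computes (chi A) k f -> turing_le A B -> computes (chi B) k f.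
Proof.
move=> [c eval_c] [q eval_q]; exists (subst_query q c) => v /eval_c.
exact: eval_subst_query.
Qed.

Lemma fun_computable_trans A B f :
  fun_computable_in A f -> turing_le A B -> fun_computable_in B f.
Proof.
move=> /fun_computableP cf leAB; apply/fun_computableP.
exact: computes_trans leAB.
Qed.

Lemma turing_le_refl A : turing_le A A.
Proof. by exists Query => x; exact: (eval_query _ [:: x]). Qed.

Lemma turing_le_trans A B C : turing_le A B -> turing_le B C -> turing_le A C.
Proof. exact: fun_computable_trans. Qed.

Lemma computes_nth O k i : computes O k (fun v => nth 0 v i).
Proof. by exists (Proj i) => v _; constructor. Qed.
#[local] Hint Resolve computes_nth : core.

Lemma computes_comp O k f (gs : seq (seq nat -> nat)) :
  computes O (size gs) f ->
  (forall i, i < size gs -> computes O k (nth (fun=> 0) gs i)) ->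
  computes O k (fun v => f [seq g v | g <- gs]).
Proof.
move=> [c eval_c] comp_gs.
have [cs [sz_cs eval_cs]] : exists cs, size cs = size gs /\ forall i, i < size gs ->
   forall v, size v = k -> eval O (nth Zero cs i) v (nth (fun=> 0) gs i v).
  elim: {c eval_c} gs comp_gs => [|g gs IH] comp_gs; first by exists [::].
  have [cs [sz_cs eval_cs]] := IH (fun i => comp_gs i.+1).
  have [c eval_c] := comp_gs 0 (ltn0Sn _).
  by exists (c :: cs); split=> [|[|i]] //=; rewrite ?sz_cs // => /eval_cs.
exists (Comp c cs) => v sz_v; apply: (@eval_comp _ _ _ _ [seq g v | g <- gs]).
- by rewrite size_map sz_cs.
- by move=> i; rewrite sz_cs => lt_i; rewrite (nth_map (fun=> 0)) //; exact: eval_cs.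
- by apply: eval_c; rewrite size_map.
Qed.

Lemma computes_reindex O k f rs : computes O (size rs) f ->
  computes O k (fun v => f [seq nth 0 v r | r <- rs]).
Proof.
move=> comp_f; pose gs := [seq (fun v : seq nat => nth 0 v r) | r <- rs].
have := @computes_comp O k f gs; rewrite size_map => /(_ comp_f) comp.
apply: eq_computes (comp _) => [v _|i lt_i]; first by rewrite -map_comp.
by rewrite (nth_map 0).
Qed.

Lemma computes1 O k (f : nat -> nat) g :
  computes O 1 (fun v => f (nth 0 v 0)) -> computes O k g ->
  computes O k (fun v => f (g v)).
Proof. by move=> cf cg; apply: (@computes_comp O k _ [:: g]) cf _ => -[|]. Qed.

Lemma computes2 O k (f : nat -> nat -> nat) g h :
  computes O 2 (fun v => f (nth 0 v 0) (nth 0 v 1)) ->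
  computes O k g -> computes O k h -> computes O k (fun v => f (g v) (h v)).
Proof.
by move=> cf cg ch; apply: (@computes_comp O k _ [:: g; h]) cf _ => -[|[|]].
Qed.

Lemma computes_oracle A k g :
  computes (chi A) k g -> computes (chi A) k (fun v => chi A (g v)).
Proof. by apply: computes1; apply/fun_computableP; exact: turing_le_refl. Qed.

Lemma computes_succ O k g : computes O k g -> computes O k (fun v => (g v).+1).
Proof. by apply: computes1; exists Succ => v _; constructor. Qed.

Lemma computes_const O k n : computes O k (fun=> n).
Proof.
elim: n => [|n IH]; last exact: computes_succ.
by exists Zero => v _; constructor.
Qed.
#[local] Hint Resolve computes_const : core.

Lemma set0_turing_le A : turing_le set0 A.
Proof.
apply/fun_computableP; apply: eq_computes (computes_const (chi A) 1 0) => v _.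
by rewrite /chi asboolF.
Qed.

Lemma computes_rec_param O (f : nat -> nat -> nat) a b :
  (forall y, f 0 y = a y) -> (forall n y, f n.+1 y = b n (f n y) y) ->
  computes O 1 (fun v => a (nth 0 v 0)) ->
  computes O 3 (fun v => b (nth 0 v 0) (nth 0 v 1) (nth 0 v 2)) ->
  computes O 2 (fun v => f (nth 0 v 0) (nth 0 v 1)).
Proof.
move=> f0 fS [ca eval_a] [cb eval_b]; exists (Prec ca cb) => -[|n [|y []]] //= _.
elim: n => [|n IH]; first by apply: eval_prec0; rewrite f0; exact: (eval_a [:: y]).
by apply: eval_precS IH _; rewrite fS; exact: (eval_b [:: _; _; _]).
Qed.

Lemma computes_rec O (f : nat -> nat) b :
  (forall n, f n.+1 = b n (f n)) ->
  computes O 2 (fun v => b (nth 0 v 0) (nth 0 v 1)) ->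
  computes O 1 (fun v => f (nth 0 v 0)).
Proof.
move=> fS comp_b; pose F n (_ : nat) := f n.
apply: (@computes2 _ _ F _ _ _ (computes_nth _ _ 0) (computes_nth _ _ 0)).
apply: (@computes_rec_param _ _ (fun=> f 0) (fun n z _ => b n z)) => // [n y|].
  exact: fS.
exact: (@computes2 _ _ b).
Qed.

Lemma computes_add O k g h : computes O k g -> computes O k h ->
  computes O k (fun v => g v + h v).
Proof.
apply: computes2; apply: (@computes_rec_param _ _ id (fun _ z _ => z.+1)) => //.
exact: computes_succ.
Qed.

Lemma computes_mul O k g h : computes O k g -> computes O k h ->
  computes O k (fun v => g v * h v).
Proof.
apply: computes2; apply: (@computes_rec_param _ _ (fun=> 0) (fun _ z y => y + z)) => //.
exact: computes_add.
Qed.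

Lemma computes_pred O k g : computes O k g -> computes O k (fun v => (g v).-1).
Proof. by apply: computes1; exact: (@computes_rec _ predn (fun n _ => n)). Qed.

Lemma computes_sub O k g h : computes O k g -> computes O k h ->
  computes O k (fun v => g v - h v).
Proof.
move=> cg ch; apply: (@computes2 _ _ (fun n m => m - n) h g) => //.
apply: (@computes_rec_param _ (fun n m => m - n) id (fun _ z _ => z.-1)) => //.
- exact: subn0.
- by move=> n y; rewrite subnS.
- exact: computes_pred.
Qed.

Lemma computes_negb O k (g : seq nat -> bool) :
  computes O k g -> computes O k (fun v => ~~ g v).
Proof.
move=> cg; apply: eq_computes (computes_sub (computes_const O k 1) cg) => v _.
by case: (g v).
Qed.

Lemma computes_andb O k (g h : seq nat -> bool) :
  computes O k g -> computes O k h -> computes O k (fun v => g v && h v).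
Proof.
by move=> cg ch; apply: eq_computes (computes_mul cg ch) => v _; rewrite mulnb.
Qed.

Lemma computes_leq O k g h : computes O k g -> computes O k h ->
  computes O k (fun v => g v <= h v).
Proof.
move=> cg ch.
apply: eq_computes (computes_sub (computes_const O k 1) (computes_sub cg ch)) => v _.
by rewrite /leq; case: (g v - h v).
Qed.

Lemma computes_eq O k g h : computes O k g -> computes O k h ->
  computes O k (fun v => g v == h v).
Proof.
move=> cg ch.
apply: eq_computes (computes_andb (computes_leq cg ch) (computes_leq ch cg)) => v _.
by rewrite eqn_leq.
Qed.

Lemma computes_odd O k g : computes O k g -> computes O k (fun v => odd (g v)).
Proof.
apply: (@computes1 _ _ (fun n => odd n)).
apply: (@computes_rec _ (fun n => odd n) (fun _ z => 1 - z)).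
  by move=> n /=; case: (odd n).
exact: computes_sub.
Qed.

Lemma computes_half O k g : computes O k g -> computes O k (fun v => (g v)./2).
Proof.
apply: computes1; apply: (@computes_rec _ half (fun n z => odd n + z)).
  by move=> n /=; rewrite uphalf_half.
by apply: computes_add => //; exact: computes_odd.
Qed.

Lemma computes_double O k g : computes O k g -> computes O k (fun v => (g v).*2).
Proof.
by move=> cg; apply: eq_computes (computes_add cg cg) => v _; rewrite addnn.
Qed.

Lemma rel_computable_reindex O k Q rs : rel_computable_in O (size rs) Q ->
  rel_computable_in O k (fun v => Q [seq nth 0 v r | r <- rs]).
Proof. exact: (@computes_reindex _ _ (fun v => `[< Q v >])). Qed.

Lemma rel_computable_not O k Q : rel_computable_in O k Q ->
  rel_computable_in O k (fun v => ~ Q v).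
Proof.
by move/computes_negb; apply: eq_computes => v _; rewrite asbool_neg.
Qed.

Lemma rel_computable_and O k Q R : rel_computable_in O k Q ->
  rel_computable_in O k R -> rel_computable_in O k (fun v => Q v /\ R v).
Proof.
move=> cQ cR; apply: eq_computes (computes_andb cQ cR) => v _.
by rewrite asbool_and.
Qed.

Lemma rel_computable_eq A k g h : computes (chi A) k g -> computes (chi A) k h ->
  rel_computable_in A k (fun v => g v = h v).
Proof.
move=> cg ch; apply: eq_computes (computes_eq cg ch) => v _.
by congr nat_of_bool; apply/eqP/asboolP.
Qed.

Lemma rel_computable_leq A k g h : computes (chi A) k g -> computes (chi A) k h ->
  rel_computable_in A k (fun v => g v <= h v).
Proof.
by move=> cg ch; apply: eq_computes (computes_leq cg ch) => v _; rewrite asboolb.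
Qed.

Lemma fun_computable_least_search A (R : nat -> nat -> bool) (f : nat -> nat) :
  computes (chi A) 2 (fun v => R (nth 0 v 0) (nth 0 v 1)) ->
  (forall n, R (f n) (f n.+1)) -> (forall n m, R (f n) m -> f n.+1 <= m) ->
  fun_computable_in A f.
Proof.
move=> comp_R Rf f_min.
have [test eval_test] : computes (chi A) 2 (fun v => ~~ R (nth 0 v 1) (nth 0 v 0)).
  exact/computes_negb/(@computes2 _ _ (fun x y => R x y)).
have [start eval_start] := computes_const (chi A) 0 (f 0).
exists (Prec start (Comp (Mu test) [:: Proj 1])).
elim=> [|n IH]; first by apply: eval_prec0; exact: eval_start.
apply: eval_precS IH _; apply: (@eval_comp _ _ _ _ [:: f n]) => //.
  by case=> // _; exact: (eval_proj _ 1 [:: n; f n]).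
apply: (@eval_mu _ _ _ _ (fun=> 0)) => [m lt_m|].
  have := eval_test [:: m; f n] erefl; rewrite /=.
  by case: (boolP (R (f n) m)) => // /f_min; rewrite leqNgt lt_m.
by have := eval_test [:: f n.+1; f n] erefl; rewrite /= Rf.
Qed.

(** * Coding of pairs, finite sets and finite sequences *)

Definition pairn (i m : nat) : nat := iter i double m.*2.+1.

Lemma computes_pairn O k g h : computes O k g -> computes O k h ->
  computes O k (fun v => pairn (g v) (h v)).
Proof.
apply: (@computes2 _ _ pairn).
apply: (@computes_rec_param _ pairn (fun y => y.*2.+1) (fun _ z _ => z.*2)) => //.
  exact/computes_succ/computes_double.
exact: computes_double.
Qed.

Lemma leq_pairn i m : m <= pairn i m.
Proof.
elim: i => [|i IH] /=; first by rewrite -addnn -addSn leq_addl.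
by apply: leq_trans IH _; rewrite -addnn leq_addl.
Qed.

Lemma pairn_inj i m j n : pairn i m = pairn j n -> i = j /\ m = n.
Proof.
elim: i j => [|i IH] [|j] /=.
- by move=> [/double_inj].
- by move/(congr1 odd); rewrite /= !odd_double.
- by move/(congr1 odd); rewrite /= !odd_double.
- by move/double_inj/IH => [-> ->].
Qed.

Definition column (W : set nat) (i : nat) : set nat := [set m | W (pairn i m)].

Definition bits (x : nat) : set nat := [set a | odd (iter a half x)].

Lemma computes_bits O k g h : computes O k g -> computes O k h ->
  computes O k (fun v => chi (bits (g v)) (h v)).
Proof.
move=> cg ch; apply: (@eq_computes _ _ (fun v => odd (iter (h v) half (g v)))).
  by move=> v _; rewrite /chi asboolb.
apply/computes_odd/(@computes2 _ _ (fun a x => iter a half x)) => //.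
apply: (@computes_rec_param _ (fun a x => iter a half x) id (fun _ z _ => z./2)) => //.
exact: computes_half.
Qed.

Lemma bits0 a : ~ bits 0 a.
Proof. by rewrite /bits /=; have -> : iter a half 0 = 0 by elim: a => // a /= ->. Qed.

Lemma bits_leq x a : bits x a -> a <= x.
Proof.
rewrite /bits /=; elim: a x => // a IH [|x]; first by move/(@bits0 a.+1).
rewrite iterSr => /IH le_a; apply: leq_ltn_trans le_a _; rewrite ltn_half_double.
by rewrite -addnn -[X in X < _]addn0 ltn_add2l.
Qed.

Lemma bits_surj A n : exists x, bits x = A `&` `I_n.
Proof.
elim: n A => [|n IH] A; first by exists 0; apply/seteqP; split=> a; [move/bits0 | case].
have [x bits_x] := IH (fun a => A a.+1).
have bits_xS a : bits x a <-> a < n /\ A a.+1 by rewrite bits_x; split=> -[].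
exists (`[< A 0 >] + x.*2); apply/funext => -[|a]; apply/propext.
  by rewrite /bits /= oddD odd_double oddb addbF; split=> [/asboolP|[/asboolP]].
rewrite /bits /= -iterS iterSr half_bit_double.
by split=> [/bits_xS[]|[Aa lt_a]] //; apply/bits_xS.
Qed.

(* The disjunct [m = v] only serves to make the search in [entry] total. *)
Definition is_entry (v j m : nat) : Prop := bits v (pairn j m) \/ m = v.

Lemma is_entry_total v j : exists m, `[< is_entry v j m >].
Proof. by exists v; apply/asboolP; right. Qed.

Definition entry (v j : nat) : nat := ex_minn (is_entry_total v j).

Lemma entryP v j m :
  m = entry v j <-> is_entry v j m /\ forall i, i < m -> ~ is_entry v j i.
Proof.
rewrite /entry; case: ex_minnP => n /asboolP entry_n n_min.
split=> [-> | [entry_m m_min]].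
  by split=> // i lt_i /asboolP/n_min; rewrite leqNgt lt_i.
case: (ltngtP m n) => // [lt_m|/m_min //].
by move/asboolP/n_min: entry_m; rewrite leqNgt lt_m.
Qed.

Lemma entry_surj (js : seq nat) (f : nat -> nat) :
  exists v, forall j, j \in js -> entry v j = f j.
Proof.
pose N := (\max_(j <- js) pairn j (f j)).+1.
have [v bits_v] := bits_surj [set a | exists2 j, j \in js & a = pairn j (f j)] N.
exists v => j js_j; apply/esym/entryP.
have bits_j : bits v (pairn j (f j)).
  rewrite bits_v; split; first by exists j.
  by rewrite /= ltnS (@leq_bigmax_seq _ js xpredT (fun j => pairn j (f j))).
split=> [|m lt_m]; first by left.
case=> [|e].
  by rewrite bits_v => -[[i _ /pairn_inj[<- e]] _]; rewrite e ltnn in lt_m.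
by move: lt_m; rewrite e ltnNge (leq_trans (leq_pairn j _) (bits_leq bits_j)).
Qed.

Lemma entry_surj_ltn k (f : nat -> nat) : exists v, forall j, j < k -> entry v j = f j.
Proof.
have [v entry_v] := entry_surj (iota 0 k) f; exists v => j lt_j.
by apply: entry_v; rewrite mem_iota.
Qed.

(** * Arithmetical predicates *)

Definition scons (x : nat) (e : nat -> nat) (n : nat) : nat :=
  if n is m.+1 then e m else x.

(* First-order definability over the computable relations, for predicates of an *)
(* environment assigning values to de Bruijn variables.                         *)
Inductive arith : ((nat -> nat) -> Prop) -> Prop :=
| arith_base k Q rs : rel_computable_in set0 k Q -> size rs = k ->
    arith (fun e => Q [seq e r | r <- rs])
| arith_not P : arith P -> arith (fun e => ~ P e)
| arith_and P Q : arith P -> arith Q -> arith (fun e => P e /\ Q e)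
| arith_ex P : arith P -> arith (fun e => exists x, P (scons x e)).

Definition arith_term (t : (nat -> nat) -> nat) : Prop :=
  arith (fun e => e 0 = t (fun n => e n.+1)).

Definition arith_set (A : set nat) : Prop := arith (fun e => A (e 0)).

Lemma eq_arith P Q : (forall e, P e <-> Q e) -> arith P -> arith Q.
Proof. by move=> e; suff -> : P = Q by []; apply/funext => x; apply/propext. Qed.

Lemma arith_exists (P : (nat -> nat) -> nat -> Prop) :
  arith (fun e => P (fun n => e n.+1) (e 0)) -> arith (fun e => exists x, P e x).
Proof. exact: arith_ex. Qed.

Lemma arith_forall (P : (nat -> nat) -> nat -> Prop) :
  arith (fun e => P (fun n => e n.+1) (e 0)) -> arith (fun e => forall x, P e x).
Proof.
move=> /arith_not aP.
apply: eq_arith (arith_not (@arith_exists (fun e x => ~ P e x) aP)) => e.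
by rewrite -not_forallP.
Qed.

Lemma arith_or P Q : arith P -> arith Q -> arith (fun e => P e \/ Q e).
Proof.
move=> aP aQ; apply: eq_arith (arith_not (arith_and (arith_not aP) (arith_not aQ))) => e.
by rewrite not_andE !notK.
Qed.

Lemma arith_imp P Q : arith P -> arith Q -> arith (fun e => P e -> Q e).
Proof.
by move=> aP aQ; apply: eq_arith (arith_or (arith_not aP) aQ) => e; rewrite implyE.
Qed.

Lemma arith_iff P Q : arith P -> arith Q -> arith (fun e => P e <-> Q e).
Proof. by move=> aP aQ; apply: arith_and; apply: arith_imp. Qed.

Lemma arith_rename P (r : nat -> nat) :
  arith P -> arith (fun e => P (fun n => e (r n))).
Proof.
move=> aP; elim: aP r => {P}.
- move=> k Q rs comp_Q sz_rs r.
  apply: eq_arith (@arith_base k Q (map r rs) comp_Q _) => [e|].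
    by rewrite -map_comp.
  by rewrite size_map.
- by move=> P _ IH r; exact: arith_not (IH r).
- by move=> P Q _ IHP _ IHQ r; exact: arith_and (IHP r) (IHQ r).
- move=> P _ IH r; pose r' n := if n is m.+1 then (r m).+1 else 0.
  apply: eq_arith (arith_ex (IH r')) => e.
  suff scons_r x : (fun n => scons x e (r' n)) = scons x (fun n => e (r n)).
    by split=> -[x Px]; exists x; rewrite scons_r in Px *.
  by apply/funext => -[].
Qed.

Lemma arith_term_shift t : arith_term t -> arith_term (fun e => t (fun n => e n.+1)).
Proof. exact: (@arith_rename _ (fun n => if n is m.+1 then m.+2 else 0)). Qed.

Lemma arith_rel2 (R : nat -> nat -> Prop) i j :
  rel_computable_in set0 2 (fun v => R (nth 0 v 0) (nth 0 v 1)) ->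
  arith (fun e => R (e i) (e j)).
Proof.
by move=> cR; apply: (@arith_base 2 (fun v => R (nth 0 v 0) (nth 0 v 1)) [:: i; j]).
Qed.

Lemma arith_rel3 (R : nat -> nat -> nat -> Prop) i j k :
  rel_computable_in set0 3 (fun v => R (nth 0 v 0) (nth 0 v 1) (nth 0 v 2)) ->
  arith (fun e => R (e i) (e j) (e k)).
Proof.
move=> cR; pose Q v := R (nth 0 v 0) (nth 0 v 1) (nth 0 v 2).
exact: (@arith_base 3 Q [:: i; j; k]).
Qed.

Lemma arith_var i : arith_term (fun e => e i).
Proof. by apply: (@arith_rel2 (fun x y => x = y)); exact: rel_computable_eq. Qed.

Lemma arith_const c : arith_term (fun=> c).
Proof. by apply: (@arith_rel2 (fun x _ => x = c) 0 0); exact: rel_computable_eq. Qed.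

Lemma arith_subst_scons P t :
  arith P -> arith_term t -> arith (fun e => P (scons (t e) e)).
Proof.
move=> aP a_t; apply: eq_arith (arith_ex (arith_and a_t aP)) => e.
by split=> [[x [/= ->]]|Pt] //; exists (t e).
Qed.

Lemma arith_app1 (R : nat -> Prop) t :
  arith (fun e => R (e 0)) -> arith_term t -> arith (fun e => R (t e)).
Proof. exact: arith_subst_scons. Qed.

Lemma arith_app2 (R : nat -> nat -> Prop) t u :
  arith (fun e => R (e 0) (e 1)) -> arith_term t -> arith_term u ->
  arith (fun e => R (t e) (u e)).
Proof.
by move=> aR /arith_term_shift a_t; exact: arith_subst_scons (arith_subst_scons aR a_t).
Qed.

Lemma arith_app3 (R : nat -> nat -> nat -> Prop) t u w :
  arith (fun e => R (e 0) (e 1) (e 2)) -> arith_term t -> arith_term u -> arith_term w ->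
  arith (fun e => R (t e) (u e) (w e)).
Proof.
move=> aR /arith_term_shift/arith_term_shift a_t /arith_term_shift a_u.
exact: arith_subst_scons (arith_subst_scons (arith_subst_scons aR a_t) a_u).
Qed.

Lemma arith_fun2 (f : nat -> nat -> nat) t u :
  arith_term (fun e => f (e 0) (e 1)) -> arith_term t -> arith_term u ->
  arith_term (fun e => f (t e) (u e)).
Proof.
move=> af /arith_term_shift a_t /arith_term_shift a_u.
exact: (@arith_app3 (fun z x y => z = f x y) _ _ _ af (arith_var 0)).
Qed.

Lemma arith_base_terms k Q (s : nat -> (nat -> nat) -> nat) rs :
  (forall r, arith_term (s r)) -> rel_computable_in set0 k Q -> size rs = k ->
  arith (fun e => Q [seq s r e | r <- rs]).
Proof.
move=> a_s comp_Q sz_rs.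
suff arith_cat rs' : size (rs ++ rs') = k ->
    arith (fun e => Q ([seq s r e | r <- rs] ++ map e rs')).
  by apply: eq_arith (arith_cat [::] _) => [e|]; rewrite cats0.
elim/last_ind: rs s rs' a_s {sz_rs} => [|rs r IH] s rs' a_s sz.
  exact: arith_base comp_Q sz.
have := IH _ (0 :: map succn rs') (fun r => arith_term_shift (a_s r)).
rewrite size_cat /= size_map addnS -addSn -(size_rcons rs r) -size_cat => /(_ sz) aQ.
apply: eq_arith (arith_subst_scons aQ (a_s r)) => e.
by rewrite map_rcons cat_rcons /= -map_comp.
Qed.

Lemma arith_subst P (s : (nat -> nat) -> nat -> nat) :
  arith P -> (forall i, arith_term (s^~ i)) -> arith (fun e => P (s e)).
Proof.
move=> aP; elim: aP s => {P}.
- by move=> k Q rs comp_Q sz_rs s a_s; exact: arith_base_terms a_s comp_Q sz_rs.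
- by move=> P _ IH s a_s; exact: arith_not (IH _ a_s).
- by move=> P Q _ IHP _ IHQ s a_s; exact: arith_and (IHP _ a_s) (IHQ _ a_s).
- move=> P _ IH s a_s; apply: arith_exists.
  apply: (IH (fun e => scons (e 0) (s (fun n => e n.+1)))) => -[|i].
    exact: (arith_var 0).
  exact: arith_term_shift (a_s i).
Qed.

Lemma arith_eq t u : arith_term t -> arith_term u -> arith (fun e => t e = u e).
Proof. exact: arith_app2 (arith_var 0). Qed.

Lemma arith_leq t u : arith_term t -> arith_term u -> arith (fun e => t e <= u e).
Proof.
apply: (@arith_app2 (fun x y => x <= y)); apply: (@arith_rel2 (fun x y => x <= y)).
exact: rel_computable_leq.
Qed.

Lemma arith_succ t : arith_term t -> arith_term (fun e => (t e).+1).
Proof.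
move=> /arith_term_shift; apply: (@arith_app2 (fun y x => y = x.+1)) (arith_var 0).
apply: (@arith_rel2 (fun y x => y = x.+1)).
by apply: rel_computable_eq => //; exact: computes_succ.
Qed.

Lemma arith_computes_fun2 (f : nat -> nat -> nat) t u :
  computes (chi set0) 3 (fun v => f (nth 0 v 1) (nth 0 v 2)) ->
  arith_term t -> arith_term u -> arith_term (fun e => f (t e) (u e)).
Proof.
move=> cf; apply: arith_fun2.
by apply: (@arith_rel3 (fun z x y => z = f x y)); exact: rel_computable_eq.
Qed.

Lemma arith_pairn t u : arith_term t -> arith_term u ->
  arith_term (fun e => pairn (t e) (u e)).
Proof. by apply: arith_computes_fun2; exact: computes_pairn. Qed.

Lemma arith_bits t u : arith_term t -> arith_term u -> arith (fun e => bits (t e) (u e)).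
Proof.
by apply: (@arith_app2 bits); apply: (@arith_rel2 bits); exact: computes_bits.
Qed.

Lemma arith_chi_bits t u : arith_term t -> arith_term u ->
  arith_term (fun e => chi (bits (t e)) (u e)).
Proof.
by apply: (@arith_computes_fun2 (fun x => chi (bits x))); exact: computes_bits.
Qed.

Lemma arith_entry t u : arith_term t -> arith_term u ->
  arith_term (fun e => entry (t e) (u e)).
Proof.
have a_is_entry w : arith_term w -> arith (fun e => is_entry (e 2) (e 3) (w e)).
  move=> a_w; apply: arith_or; last exact: arith_eq (arith_var 2).
  by apply: arith_bits; [exact: arith_var | apply: arith_pairn => //; exact: arith_var].
apply: arith_fun2.
apply: (@eq_arith (fun e => is_entry (e 1) (e 2) (e 0) /\
    forall m, m < e 0 -> ~ is_entry (e 1) (e 2) m)).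
  by move=> e; rewrite entryP.
apply: arith_and; first exact: arith_rename predn (a_is_entry _ (arith_var 1)).
apply: arith_forall; apply: arith_imp.
  by apply: arith_leq; [apply: arith_succ|]; exact: arith_var.
exact/arith_not/a_is_entry/arith_var.
Qed.

Lemma arith_prop (P : Prop) : arith (fun=> P).
Proof.
have a0 : arith (fun e => e 0 = e 0) by apply: arith_eq; exact: arith_var.
have [p|np] := pselect P; first by apply: eq_arith a0.
by apply: eq_arith (arith_not a0).
Qed.

Lemma arith_forall_in (T : eqType) (s : seq T) (P : T -> (nat -> nat) -> Prop) :
  (forall x, x \in s -> arith (P x)) -> arith (fun e => forall x, x \in s -> P x e).
Proof.
elim: s => [|x s IH] aP.
  by apply: (@eq_arith (fun=> True)) => //; exact: arith_prop.
have aPs := IH (fun y s_y => aP y (@mem_behead _ (x :: s) y s_y)).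
apply: eq_arith (arith_and (aP x (mem_head x s)) aPs) => e; split=> [[Px Ps] y|Ps].
  by rewrite inE => /predU1P[->|/Ps].
by split=> [|y s_y]; apply: Ps; rewrite inE ?eqxx // s_y orbT.
Qed.

Lemma arith_forall_ltn k (P : nat -> (nat -> nat) -> Prop) :
  (forall i, i < k -> arith (P i)) -> arith (fun e => forall i, i < k -> P i e).
Proof.
move=> aP; apply: eq_arith (@arith_forall_in _ (iota 0 k) P _) => [e|i].
  by split=> Pe i; have := Pe i; rewrite mem_iota.
by rewrite mem_iota; exact: aP.
Qed.

Ltac arith_step :=
  cbv beta;
  lazymatch goal with
  | |- arith_term (fun e => e _) => apply: arith_var
  | |- arith_term (fun e => (@?t e).+1) => apply: arith_succ
  | |- arith_term (fun e => pairn (@?t e) (@?u e)) => apply: arith_pairn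
  | |- arith_term (fun e => entry (@?t e) (@?u e)) => apply: arith_entry
  | |- arith_term (fun e => chi (bits (@?t e)) (@?u e)) => apply: arith_chi_bits
  | |- arith_term (fun=> _) => apply: arith_const
  | |- arith (fun e => @?P e /\ @?Q e) => apply: arith_and
  | |- arith (fun e => @?P e \/ @?Q e) => apply: arith_or
  | |- arith (fun e => @?P e <-> @?Q e) => apply: arith_iff
  | |- arith (fun e => ~ @?P e) => apply: arith_not
  | |- arith (fun e => forall x : ?T, is_true (x \in _) -> @?P e x) =>
      apply: arith_forall_in => ? ?
  | |- arith (fun e => forall x : nat, @?P e x) => apply: arith_forall
  | |- arith (fun e => @?P e -> @?Q e) => apply: arith_imp
  | |- arith (fun e => exists x : nat, @?P e x) => apply: arith_exists
  | |- arith (fun e => @?t e = @?u e :> nat) => apply: arith_eq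
  | |- arith (fun e => is_true (@?t e <= @?u e)) => apply: arith_leq
  | |- arith (fun e => bits (@?t e) (@?u e)) => apply: arith_bits
  | H : arith_set ?A |- arith (fun e => ?A (@?t e)) => apply: (arith_app1 H)
  | H : arith (fun e => ?R (e 0)) |- arith (fun e => ?R (@?t e)) =>
      apply: (arith_app1 H)
  | H : arith (fun e => ?R (e 0) (e 1)) |- arith (fun e => ?R (@?t e) (@?u e)) =>
      apply: (arith_app2 H)
  | H : arith (fun e => ?R (e 0) (e 1) (e 2)) |-
      arith (fun e => ?R (@?t e) (@?u e) (@?w e)) => apply: (arith_app3 H)
  | |- arith (fun=> _) => apply: arith_prop
  end.
Ltac arith_auto := repeat arith_step.

Lemma arith_set_of_chi_graph (X : set nat) (R : nat -> nat -> Prop) :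
  arith (fun e => R (e 0) (e 1)) -> (forall a, R a (chi X a)) ->
  (forall a y z, R a y -> R a z -> y = z) -> arith_set X.
Proof.
move=> aR R_chi R_fun; apply: (@eq_arith (fun e => R (e 0) 1)); last by arith_auto.
move=> e; split=> [R1|Xe]; last by have := R_chi (e 0); rewrite /chi asboolT.
apply: contrapT => nXe; have := R_fun _ _ _ R1 (R_chi (e 0)).
by rewrite /chi asboolF.
Qed.

(** * Prenex normal forms *)

Lemma alternating_congr ex n P Q v w :
  (forall ys, size ys = n -> (P (v ++ ys) <-> Q (w ++ ys))) ->
  alternating ex n P v <-> alternating ex n Q w.
Proof.
elim: n ex v w => [|n IH] ex v w PQ; first by have := PQ [::] erefl; rewrite !cats0.
have PQ_rcons y ex' :
    alternating ex' n P (rcons v y) <-> alternating ex' n Q (rcons w y).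
  by apply: IH => ys sz_ys; rewrite !cat_rcons; apply: PQ => /=; rewrite sz_ys.
case: ex => /=; first by split=> -[y /PQ_rcons]; exists y.
by split=> alt y; apply/PQ_rcons.
Qed.

Lemma alternating_not ex n P v :
  ~ alternating ex n P v <-> alternating (~~ ex) n (fun w => ~ P w) v.
Proof.
elim: n ex v => [|n IH] [] v //=.
  by rewrite -forallNP; split=> alt y; have := alt y; rewrite (IH false).
by rewrite -existsNP; split=> -[y alt]; exists y; move: alt; rewrite (IH true).
Qed.

Lemma alternating_and ex n (R : Prop) P v :
  R /\ alternating ex n P v <-> alternating ex n (fun w => R /\ P w) v.
Proof.
elim: n ex v => [|n IH] [] v //=.
  split=> [[r [y alt]]|[y /IH[r alt]]]; first by exists y; apply/IH.
  by split=> //; exists y.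
split=> [[r alt] y|alt]; first by apply/IH.
by split=> [|y]; [have /IH[] := alt 0 | have /IH[] := alt y].
Qed.

Lemma alternating_add ex m n P v :
  alternating ex (m + n) P v <->
  alternating ex m (alternating (ex (+) odd m) n P) v.
Proof.
elim: m ex v => [|m IH] ex v; first by rewrite /= addbF.
have -> : ex (+) odd m.+1 = ~~ ex (+) odd m by rewrite /= addbN addNb.
case: ex => /=; first by split=> -[y /IH]; exists y.
by split=> alt y; apply/IH.
Qed.

Definition skip (k d : nat) (w : seq nat) : seq nat := take k w ++ drop (k + d) w.

Lemma skip_cat v ys zs : skip (size v) (size ys) (v ++ ys ++ zs) = v ++ zs.
Proof. by rewrite /skip take_size_cat // catA drop_size_cat // size_cat. Qed.

Lemma rel_computable_skip O k d n R : rel_computable_in O (k + n) R ->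
  rel_computable_in O (k + d + n) (fun w => R (skip k d w)).
Proof.
move=> cR; pose rs := iota 0 k ++ iota (k + d) n.
have := @rel_computable_reindex O (k + d + n) R rs.
rewrite size_cat !size_iota => /(_ cR).
apply: eq_computes => w sz_w; rewrite map_cat map_nth_iota0; last first.
  by rewrite sz_w -addnA leq_addr.
by rewrite map_nth_iota ?sz_w ?addKn // [take n _]take_oversize // size_drop sz_w addKn.
Qed.

Lemma alternating_skip ex n R v ys :
  alternating ex n R v <->
  alternating ex n (fun w => R (skip (size v) (size ys) w)) (v ++ ys).
Proof. by apply: alternating_congr => zs _; rewrite -catA skip_cat. Qed.

(* The environment is read backwards, so that a quantifier of [alternating], *)
(* which appends its variable at the end, binds the de Bruijn variable 0.    *)
Definition prenex (K : nat) (P : (nat -> nat) -> Prop) : Prop :=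
  forall ex, exists n R, rel_computable_in set0 (K + n) R /\
    forall v, size v = K -> (P (nth 0 (rev v)) <-> alternating ex n R v).

(* A dummy quantifier in front changes the type of the leading quantifier. *)
Lemma prenex_of_leading K P ex n R : rel_computable_in set0 (K + n) R ->
  (forall v, size v = K -> (P (nth 0 (rev v)) <-> alternating ex n R v)) -> prenex K P.
Proof.
move=> cR PR ex'; have [->|ne] := eqVneq ex' ex; first by exists n, R.
have -> : ex' = ~~ ex by case: ex ex' ne {PR} => [] [].
exists n.+1, (fun w => R (skip K 1 w)); split.
  by rewrite -add1n addnA; exact: rel_computable_skip.
move=> v sz_v; rewrite PR //.
have dummy y : alternating ex n R v <->
    alternating ex n (fun w => R (skip K 1 w)) (rcons v y).
  by rewrite -cats1 -sz_v; exact: (alternating_skip _ _ _ _ [:: y]).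
case: ex dummy {PR ne} => dummy /=; first by split=> [alt y|/(_ 0)/dummy //]; exact/dummy.
by split=> [/(dummy 0)|[y /dummy]] //; exists 0.
Qed.

Lemma prenex_base K k Q rs : rel_computable_in set0 k Q -> size rs = k ->
  prenex K (fun e => Q [seq e r | r <- rs]).
Proof.
(* Out-of-range indices read 0 on both sides. *)
move=> cQ sz_rs; pose idx r := if r < K then K - r.+1 else K.
apply: (@prenex_of_leading _ _ true 0 (fun v => Q [seq nth 0 v r | r <- map idx rs])).
  by apply: rel_computable_reindex; rewrite size_map sz_rs.
move=> v sz_v /=.
suff -> : [seq nth 0 (rev v) r | r <- rs] = [seq nth 0 v r | r <- map idx rs] by [].
rewrite -map_comp; apply: eq_map => r /=; rewrite /idx -sz_v; case: ltnP => [lt_r|le_r].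
  by rewrite nth_rev.
by rewrite !nth_default // size_rev.
Qed.

Lemma prenex_not K P : prenex K P -> prenex K (fun e => ~ P e).
Proof.
move=> /(_ true) [n [R [cR PR]]].
apply: (@prenex_of_leading _ _ false n (fun w => ~ R w)); first exact: rel_computable_not.
by move=> v sz_v; rewrite -(alternating_not true) PR.
Qed.

Lemma prenex_and K P Q : prenex K P -> prenex K Q -> prenex K (fun e => P e /\ Q e).
Proof.
move=> /(_ true) [n [R [cR PR]]] /(_ (true (+) odd n)) [m [S [cS QS]]].
pose RS w := R (skip (K + n) m w) /\ S (skip K n w).
apply: (@prenex_of_leading _ _ true (n + m) RS).
  rewrite addnA; apply: rel_computable_and; last exact: rel_computable_skip.
  rewrite -[X in rel_computable_in _ X]addn0.
  by apply: rel_computable_skip; rewrite addn0.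
move=> v sz_v; rewrite alternating_add PR // QS //.
set Sv := alternating _ m S v.
rewrite (_ : _ /\ _ <-> Sv /\ alternating true n R v); last by split=> -[].
rewrite alternating_and; apply: alternating_congr => ys sz_ys.
rewrite (_ : _ /\ _ <-> R (v ++ ys) /\ Sv); last by split=> -[].
rewrite alternating_and; apply: alternating_congr => zs sz_zs.
have -> : RS ((v ++ ys) ++ zs) = (R (skip (K + n) m ((v ++ ys) ++ zs)) /\
    S (skip K n (v ++ ys ++ zs))) by rewrite catA.
rewrite -sz_v -sz_ys -sz_zs skip_cat -size_cat.
by rewrite -[X in skip _ _ (_ ++ X)]cats0 skip_cat cats0.
Qed.

Lemma prenex_ex K P : prenex K.+1 P -> prenex K (fun e => exists x, P (scons x e)).
Proof.
move=> /(_ false) [n [R [cR PR]]].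
apply: (@prenex_of_leading _ _ true n.+1 R); first by rewrite addnS.
move=> v sz_v /=.
suff PxR x : P (scons x (nth 0 (rev v))) <-> alternating false n R (rcons v x).
  by split=> -[x /PxR]; exists x.
rewrite -PR ?size_rcons ?sz_v // rev_rcons.
by have -> : nth 0 (x :: rev v) = scons x (nth 0 (rev v)) by apply/funext => -[].
Qed.

Lemma arith_prenex P : arith P -> forall K, prenex K P.
Proof.
elim=> {P} [k Q rs cQ sz_rs|P _ IH|P Q _ IHP _ IHQ|P _ IH] K.
- exact: prenex_base cQ sz_rs.
- exact: prenex_not (IH K).
- exact: prenex_and (IHP K) (IHQ K).
- exact: prenex_ex (IH K.+1).
Qed.

Lemma arith_set_arithmetical (X : set nat) : arith_set X -> arithmetical X.
Proof.
move=> /arith_prenex /(_ 1 true) [n [R [cR XR]]].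
by exists n; left; exists R => // x; rewrite -XR.
Qed.

(** * Arithmetical definability of computations *)

Fixpoint env_take (k : nat) (e : nat -> nat) : seq nat :=
  if k is k'.+1 then e 0 :: env_take k' (fun n => e n.+1) else [::].

Lemma env_takeE k e : env_take k e = mkseq e k.
Proof.
by elim: k e => [|k IH] e //=; rewrite IH /mkseq /= -[1]/(1 + 0) iotaDl -map_comp.
Qed.

Lemma arith_term_nth_env_take k (r : nat -> nat) i :
  arith_term (fun e => nth 0 (env_take k (fun n => e (r n))) i).
Proof.
elim: k i r => [|k IH] [|i] r /=; by [arith_auto | exact: (IH i (fun n => r n.+1))].
Qed.

Lemma eval_comp_entryP O f gs v y : eval O (Comp f gs) v y <->
  exists w, (forall i, i < size gs -> eval O (nth Zero gs i) v (entry w i)) /\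
    eval O f (env_take (size gs) (entry w)) y.
Proof.
rewrite eval_compP; split=> [[ws [sz_ws eval_gs eval_f]]|[w [eval_gs eval_f]]].
  have [w entry_w] := entry_surj_ltn (size gs) (nth 0 ws); exists w; split=> [i lt_i|].
    by rewrite entry_w //; exact: eval_gs.
  suff -> : env_take (size gs) (entry w) = ws by [].
  rewrite env_takeE; apply: (@eq_from_nth _ 0); rewrite size_mkseq // => i lt_i.
  by rewrite nth_mkseq // entry_w.
exists (mkseq (entry w) (size gs)); rewrite -env_takeE; split=> // [|i lt_i].
  by rewrite env_takeE size_mkseq.
by rewrite env_takeE nth_mkseq //; exact: eval_gs.
Qed.

Lemma eval_prec_entryP O f g n v y : eval O (Prec f g) (n :: v) y <->
  exists w, eval O f v (entry w 0) /\ entry w n = y /\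
    forall i, i < n -> eval O g [:: i, entry w i & v] (entry w i.+1).
Proof.
split=> [eval_y|[w [eval0 [<- evalS]]]]; last first.
  elim: n evalS => [|n IH] evalS; first exact/eval_prec0P.
  apply/eval_precSP; exists (entry w n); last exact: evalS.
  by apply: IH => i /ltnW; exact: evalS.
suff [s [eval0 [<- evalS]]] : exists s : nat -> nat, eval O f v (s 0) /\ s n = y /\
    forall i, i < n -> eval O g [:: i, s i & v] (s i.+1).
  have [w entry_w] := entry_surj_ltn n.+1 s; exists w; rewrite !entry_w //.
  by split=> //; split=> // i lt_i; rewrite !entry_w //; [exact: evalS | exact: ltnW].
elim: n y eval_y => [|n IH] y; first by move/eval_prec0P => eval_y; exists (fun=> y).
case/eval_precSP => z /IH [s [eval0 [s_n evalS]]] eval_y.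
exists (fun i => if i == n.+1 then y else s i); split=> //; rewrite eqxx; split=> // i.
rewrite ltnS eqSS => le_i; rewrite ltn_eqF //.
by case: (ltngtP i n) le_i => // [lt_i _|-> _]; [exact: evalS | rewrite s_n].
Qed.

Definition arith_eval_code (c : code) : Prop := forall k,
  arith (fun e => eval (chi (bits (e 0))) c (env_take k (fun n => e n.+2)) (e 1)).

Lemma arith_eval_comp f gs : arith_eval_code f ->
  (forall i, i < size gs -> arith_eval_code (nth Zero gs i)) ->
  arith_eval_code (Comp f gs).
Proof.
move=> af ags k.
apply: eq_arith => [e|]; first by symmetry; exact: eval_comp_entryP.
apply: arith_exists; apply: arith_and.
  apply: arith_forall_ltn => i lt_i.
  pose s e := scons (e 1) (scons (entry (e 0) i) (fun n => e n.+3)).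
  by apply: (@arith_subst _ s (ags i lt_i k)) => -[|[|j]] /=; arith_auto.
pose s e := scons (e 1) (scons (e 2) (entry (e 0))).
by apply: (@arith_subst _ s (af (size gs))) => -[|[|j]] /=; arith_auto.
Qed.

Lemma arith_eval_prec f g :
  arith_eval_code f -> arith_eval_code g -> arith_eval_code (Prec f g).
Proof.
move=> af ag [|k] /=.
  apply: (@eq_arith (fun=> False)); last exact: arith_prop.
  by move=> e; split=> // /eval_prec_nil.
apply: eq_arith => [e|]; first by symmetry; exact: eval_prec_entryP.
apply: arith_exists; apply: arith_and; last apply: arith_and; last first.
- apply: arith_forall; apply: arith_imp; first by arith_auto.
  pose s e := scons (e 2) (scons (entry (e 1) (e 0).+1)
    (scons (e 0) (scons (entry (e 1) (e 0)) (fun n => e (5 + n))))).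
  by apply: (@arith_subst _ s (ag k.+2)) => -[|[|[|[|j]]]] /=; arith_auto.
- by arith_auto.
- pose s e := scons (e 1) (scons (entry (e 0) 0) (fun n => e n.+4)).
  by apply: (@arith_subst _ s (af k)) => -[|[|j]] /=; arith_auto.
Qed.

Lemma arith_eval_mu f : arith_eval_code f -> arith_eval_code (Mu f).
Proof.
move=> af k; apply: eq_arith => [e|]; first by symmetry; exact: eval_muP.
apply: arith_and.
  apply: arith_forall; apply: arith_imp; first by arith_auto.
  apply: arith_exists.
  pose s e := scons (e 2) (scons (e 0).+1 (scons (e 1) (fun n => e n.+4))).
  by apply: (@arith_subst _ s (af k.+1)) => -[|[|[|j]]] /=; arith_auto.
pose s e := scons (e 0) (scons 0 (scons (e 1) (fun n => e n.+2))).
by apply: (@arith_subst _ s (af k.+1)) => -[|[|[|j]]] /=; arith_auto.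
Qed.

Lemma arith_eval c : arith_eval_code c.
Proof.
elim/code_nested_ind: c => [||i||f gs|f g|f]; [| | | |
  exact: arith_eval_comp | exact: arith_eval_prec | exact: arith_eval_mu] => k.
- apply: (@eq_arith (fun e => e 1 = 0)); last by arith_auto.
  by move=> e; split=> [->|eval_y]; [constructor | inversion eval_y].
- apply: (@eq_arith (fun e => e 1 = (nth 0 (env_take k (fun n => e n.+2)) 0).+1)).
    by move=> e; split=> [->|eval_y]; [constructor | inversion eval_y].
  by apply: arith_eq (arith_succ _); [arith_auto | exact: arith_term_nth_env_take].
- apply: (@eq_arith (fun e => e 1 = nth 0 (env_take k (fun n => e n.+2)) i)).
    by move=> e; split=> [->|eval_y]; [constructor | inversion eval_y].
  by apply: arith_eq; [arith_auto | exact: arith_term_nth_env_take].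
- apply: (@eq_arith (fun e =>
      e 1 = chi (bits (e 0)) (nth 0 (env_take k (fun n => e n.+2)) 0))).
    by move=> e; split=> [->|eval_y]; [exact: eval_query | inversion eval_y].
  apply: arith_eq; [arith_auto | apply: arith_chi_bits; [arith_auto |]].
  exact: arith_term_nth_env_take.
Qed.

(** * Leftmost paths *)

(* [T n W] says that the restriction of [W] to [n] belongs to a binary tree. *)
Section LeftmostPath.
Variable T : nat -> set nat -> Prop.
Hypothesis T_restrict : forall m n A B, m <= n -> agree m A B -> T n B -> T m A.

Definition extendible (n x : nat) : Prop :=
  forall m, exists y, agree n (bits y) (bits x) /\ T m (bits y).

Definition left_extendible (n x : nat) : Prop :=
  exists y, agree n (bits y) (bits x) /\ ~ bits y n /\ extendible n.+1 y.

Definition leftmost (n x : nat) : Prop :=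
  extendible n x /\ forall i, i < n -> bits x i -> ~ left_extendible i x.

Definition leftmost_path (a : nat) : Prop := exists x, leftmost a.+1 x /\ bits x a.

Lemma extendibleW m n x : m <= n -> extendible n x -> extendible m x.
Proof.
move=> le_mn ext_x k; have [y [eyx Ty]] := ext_x k.
by exists y; split=> //; exact: agreeW eyx.
Qed.

Lemma left_extendible_agree n x y :
  agree n (bits x) (bits y) -> left_extendible n x -> left_extendible n y.
Proof.
by move=> exy [z [ezx ext_z]]; exists z; split=> //; exact: agree_trans ezx exy.
Qed.

Lemma extendible_split n x :
  extendible n x -> exists y, agree n (bits y) (bits x) /\ extendible n.+1 y.
Proof.
move=> ext_x; apply: contrapT => no_ext.
have bound (P : Prop) : exists m, forall y,
    agree n (bits y) (bits x) -> (bits y n <-> P) -> ~ T m (bits y).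
  apply: contrapT => unbounded; have [y bits_y] :=
    bits_surj (fun a => if a == n then P else bits x a) n.+1.
  have ey a : a < n -> (bits y a <-> bits x a).
    by move=> lt_a; rewrite bits_y /setI /= ltn_eqF // ltnS ltnW //; split=> [[]|].
  have yn : bits y n <-> P by rewrite bits_y /setI /= eqxx ltnSn; split=> [[]|].
  apply: no_ext; exists y; split=> // m; apply: contrapT => no_z.
  apply: unbounded; exists m => z ezx zn Tz; apply: no_z; exists z; split=> //.
  by apply: agreeS; [apply: agree_trans ezx (agree_sym ey) | rewrite zn yn].
have [m1 noT1] := bound True; have [m0 noT0] := bound False.
have [z [ezx Tz]] := ext_x (maxn m1 m0).
have [zn|zn] := pselect (bits z n).
  by apply: (noT1 z) => //; apply: T_restrict Tz => //; exact: leq_maxl.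
by apply: (noT0 z) => //; apply: T_restrict Tz => //; exact: leq_maxr.
Qed.

Lemma leftmost_unique n x y : leftmost n x -> leftmost n y -> agree n (bits x) (bits y).
Proof.
move=> lx ly; suff agree_le m : m <= n -> agree m (bits x) (bits y) by exact: agree_le.
elim: m => // m IH lt_m; have exy := IH (ltnW lt_m).
suff bit_le u v : leftmost n u -> leftmost n v -> agree m (bits u) (bits v) ->
    bits u m -> bits v m.
  by apply: agreeS => //; split; apply: bit_le => //; exact: agree_sym.
move=> [_ u_min] [ext_v _] euv um; apply: contrapT => vm.
apply: (u_min m) => //; exists v; split; first exact: agree_sym.
by split=> //; exact: extendibleW ext_v.
Qed.

Lemma leftmostW m n x : m <= n -> leftmost n x -> leftmost m x.
Proof.
move=> le_mn [ext_x x_min]; split; first exact: extendibleW ext_x.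
by move=> i lt_i; exact/x_min/(leq_trans lt_i).
Qed.

Lemma leftmost_path_agree n x : leftmost n x -> agree n (bits x) leftmost_path.
Proof.
move=> lx a lt_a; split=> [xa|[y [ly ya]]].
  by exists x; split=> //; exact: leftmostW lx.
exact/(leftmost_unique (leftmostW lt_a lx) ly).
Qed.

Lemma leftmost_exists n : (forall m, exists W, T m W) -> exists x, leftmost n x.
Proof.
move=> T_inf; elim: n => [|n [x [ext_x x_min]]].
  exists 0; split=> // m; have [W TW] := T_inf m; have [y bits_y] := bits_surj W m.
  exists y; split=> //; apply: T_restrict TW => //.
  by rewrite bits_y; exact: agree_setI_ltn.
have min_below y i :
    agree n (bits y) (bits x) -> i < n -> bits y i -> ~ left_extendible i y.
  move=> eyx lt_i /(eyx _ lt_i) xi left_y; apply: (x_min _ lt_i xi).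
  exact: left_extendible_agree (agreeW (ltnW lt_i) eyx) left_y.
have [[y [eyx [yn ext_y]]]|no_left] := pselect (left_extendible n x).
  exists y; split=> // i; rewrite ltnS leq_eqVlt => /predU1P[->|] //; exact: min_below.
have [y [eyx ext_y]] := extendible_split ext_x; exists y; split=> // i.
rewrite ltnS leq_eqVlt => /predU1P[-> _|]; last exact: min_below.
by move=> left_y; apply: no_left; exact: left_extendible_agree left_y.
Qed.

Lemma leftmost_path_in_tree :
  (forall n, exists W, T n W) -> forall n, T n leftmost_path.
Proof.
move=> T_inf n; have [x lx] := leftmost_exists n T_inf.
have [y [eyx Ty]] := lx.1 n; apply: T_restrict Ty => //.
exact/agree_sym/(agree_trans eyx)/leftmost_path_agree.
Qed.

End LeftmostPath.

Lemma arith_leftmost_path (T : nat -> nat -> set nat -> Prop) :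
  arith (fun e => T (e 0) (e 1) (bits (e 2))) ->
  arith (fun e => leftmost_path (T (e 0)) (e 1)).
Proof.
move=> aT; have aT_terms b n x : arith_term b -> arith_term n -> arith_term x ->
    arith (fun e => T (b e) (n e) (bits (x e))).
  exact: (arith_app3 (R := fun b n x => T b n (bits x))).
rewrite /leftmost_path /leftmost /left_extendible /extendible /agree.
by arith_auto; apply: aT_terms; arith_auto.
Qed.

(** * Ill-founded parts *)

Definition ill_part (L : linear_order) : set nat :=
  [set x | exists2 g, descending L g & g 0 = x].

Definition wf_part (L : linear_order) : set nat := lo_dom L `\` ill_part L.

Definition no_least (L : linear_order) (A : set nat) : Prop :=
  forall x, A x -> exists y, A y /\ lo_lt L y x.

Definition ill_coinitial (L : linear_order) (A : set nat) : Prop :=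
  forall x, ill_part L x -> exists m, A m /\ lo_lt L m x.

Section IllPart.
Variable L : linear_order.

Lemma ill_part_descending g n : descending L g -> ill_part L (g n).
Proof. by move=> Lg; exists (fun i => g (n + i)) => [i|]; rewrite ?addnS ?addn0. Qed.

Lemma ill_part_up x y : ill_part L x -> lo_lt L x y -> ill_part L y.
Proof.
move=> [g Lg g0] lt_xy; exists (fun i => if i is j.+1 then g j else y) => //.
by case=> [|i] /=; rewrite ?g0.
Qed.

Lemma ill_part_no_least : no_least L (ill_part L).
Proof. by move=> _ [g Lg <-]; exists (g 1); split=> //; exact: ill_part_descending. Qed.

Lemma no_least_sub_ill_part A : no_least L A -> A `<=` ill_part L.
Proof.
move=> A_no_least x Ax.
have /choice [pred pred_lt] y : exists z, A y -> A z /\ lo_lt L z y.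
  by have [/A_no_least [z]|] := pselect (A y); [exists z | exists 0].
have A_iter n : A (iter n pred x) by elim: n => //= n /pred_lt [].
by exists (fun n => iter n pred x) => // n; have [] := pred_lt _ (A_iter n).
Qed.

Lemma ill_part_dom : ill_part L `<=` lo_dom L.
Proof. by move=> _ [g Lg <-]; have [] := lo_lt_dom (Lg 0). Qed.

Lemma wf_part_lt_ill_part x y : wf_part L x -> ill_part L y -> lo_lt L x y.
Proof.
move=> [dom_x not_ill_x] ill_y.
case: (lo_lt_total dom_x (ill_part_dom ill_y)) => // [e|lt_yx]; case: not_ill_x.
  by rewrite e.
exact: ill_part_up lt_yx.
Qed.

Lemma descending_lt g m n : descending L g -> m < n -> lo_lt L (g n) (g m).
Proof.
move=> Lg; elim: n => // n IH; rewrite ltnS leq_eqVlt => /orP[/eqP -> //|/IH lt_nm].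
exact: lo_lt_trans (Lg n) lt_nm.
Qed.

Lemma descending_inj g : descending L g -> injective g.
Proof.
move=> Lg m n e; case: (ltngtP m n) => // /(descending_lt Lg);
  by rewrite e => /lo_lt_irrefl.
Qed.

Lemma descending_unbounded g N : descending L g -> exists n, N <= g n.+1.
Proof.
move=> Lg; apply: contrapT => bounded.
have lt_N n : g n.+1 < N by rewrite ltnNge; apply/negP => le_N; apply: bounded; exists n.
pose f (i : 'I_N.+1) : 'I_N := Ordinal (lt_N i).
have /leq_card : injective f by move=> i j [/(descending_inj Lg)[/val_inj]].
by rewrite !card_ord ltnn.
Qed.

End IllPart.

Lemma computable_order_arith L : computable_order L ->
  arith_set (lo_dom L) /\ arith (fun e => lo_lt L (e 0) (e 1)).
Proof.
move=> [dom_comp lt_comp]; split.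
  exact: (@arith_base 1 (fun v => lo_dom L (nth 0 v 0)) [:: 0]).
exact: (@arith_rel2 (lo_lt L)).
Qed.

(** * Arithmetical separation of ill-founded parts *)

Definition tuple_in (js : seq nat) (U : nat -> set nat) (v : nat) : Prop :=
  forall j, j \in js -> U j (entry v j).

Lemma tuple_in_exists js (U : nat -> set nat) :
  (forall j, j \in js -> exists x, U j x) -> exists v, tuple_in js U v.
Proof.
move=> exU; have /choice [f Uf] j : exists x, j \in js -> U j x.
  by have [/exU [x]|] := boolP (j \in js); [exists x | exists 0].
have [v entry_v] := entry_surj js f.
by exists v => j js_j; rewrite entry_v //; exact: Uf.
Qed.

Section Separation.
Variables (js : seq nat) (L : nat -> linear_order) (A : set nat).

Definition tuple_lt (w v : nat) : Prop :=
  tuple_in js (fun j x => lo_lt (L j) x (entry v j)) w.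

Definition tuple_below (n v : nat) : Prop :=
  forall j, j \in js -> pairn j (entry v j) < n.

(* For all [n] together, this says that the product of the columns of [W]        *)
(* contains [b] and that [A] separates it, up to passing to a smaller tuple,     *)
(* from the product of the complements.                                          *)
Definition separated (b n : nat) (W : set nat) : Prop :=
  (tuple_below n b -> tuple_in js (column W) b) /\
  (forall v, tuple_below n v -> tuple_in js (fun j => lo_dom (L j) `&` column W j) v ->
    exists w, tuple_lt w v /\ A w) /\
  forall v, tuple_below n v -> tuple_in js (fun j => lo_dom (L j) `\` column W j) v ->
    ~ A v.

Lemma tuple_below_exists v : exists n, tuple_below n v.
Proof.
exists (\max_(j <- js) pairn j (entry v j)).+1 => j js_j.
by rewrite ltnS (@leq_bigmax_seq _ js xpredT (fun j => pairn j (entry v j))).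
Qed.

Lemma separated_restrict b m n W V :
  m <= n -> agree m W V -> separated b n V -> separated b m W.
Proof.
move=> le_mn eWV [b_in [below disj]].
have columnE v j : tuple_below m v -> j \in js ->
    (column W j (entry v j) <-> column V j (entry v j)).
  by move=> lt_v js_j; exact: eWV (lt_v j js_j).
have leW v : tuple_below m v -> tuple_below n v.
  by move=> lt_v j /lt_v /leq_trans; exact.
split; [|split] => [lt_b j js_j|v lt_v Wv|v lt_v Wv].
- by apply/(columnE _ _ lt_b js_j); exact: b_in (leW _ lt_b) _ js_j.
- apply: below (leW _ lt_v) _ => j js_j.
  by have [domj /(columnE _ _ lt_v js_j)] := Wv j js_j.
- apply: disj (leW _ lt_v) _ => j js_j; have [domj Wj] := Wv j js_j.
  by split=> // /(columnE _ _ lt_v js_j).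
Qed.

Lemma separated_no_least b W : (forall n, separated b n W) ->
  exists2 j, j \in js & no_least (L j) (lo_dom (L j) `&` column W j).
Proof.
move=> sepW; apply: contrapT => all_least.
have [v min_v] : exists v, tuple_in js (fun j x => (lo_dom (L j) `&` column W j) x /\
    forall y, (lo_dom (L j) `&` column W j) y -> ~ lo_lt (L j) y x) v.
  apply: tuple_in_exists => j js_j; apply: contrapT => no_min; apply: all_least.
  exists j => // x Wx; apply: contrapT => x_min; apply: no_min; exists x.
  by split=> // y Wy lt_yx; apply: x_min; exists y.
have [n lt_v] := tuple_below_exists v; have [_ [below _]] := sepW n.
have [|w [lt_wv Aw]] := below v lt_v; first by move=> j /min_v[].
have [m lt_w] := tuple_below_exists w; have [_ [_ disj]] := sepW m.
apply: disj lt_w _ Aw => j js_j; have lt_j := lt_wv j js_j.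
have [domj _] := lo_lt_dom lt_j; split=> // Wj.
by have [_ /(_ _ (conj domj Wj))] := min_v j js_j.
Qed.

Lemma separated_ill_part b n :
  tuple_in js (ill_part \o L) `<=` A ->
  tuple_in js (wf_part \o L) `<=` ~` A ->
  tuple_in js (ill_part \o L) b ->
  exists W, separated b n W.
Proof.
move=> ill_A wf_A ill_b.
pose W : set nat := [set a | exists j x, a = pairn j x /\ ill_part (L j) x]; exists W.
have columnW j x : column W j x <-> ill_part (L j) x.
  by split=> [[i [y [/pairn_inj[-> ->]]]]|] //; exists j, x.
split; [|split] => [_ j js_j|v _ Wv|v _ Wv].
- by apply/columnW; exact: ill_b.
- have [|w lt_wv] := @tuple_in_exists js
      (fun j x => ill_part (L j) x /\ lo_lt (L j) x (entry v j)).
    by move=> j /Wv [_ /columnW /ill_part_no_least].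
  by exists w; split=> [j /lt_wv[]|] //; apply: ill_A => j /lt_wv[].
- by apply: wf_A => j /Wv [domj nWj]; split=> // /columnW.
Qed.

Hypothesis dom_arith : forall j, j \in js -> arith_set (lo_dom (L j)).
Hypothesis lt_arith : forall j, j \in js -> arith (fun e => lo_lt (L j) (e 0) (e 1)).
Hypothesis A_arith : arith_set A.

Lemma arith_separated : arith (fun e => separated (e 0) (e 1) (bits (e 2))).
Proof.
have adom j t : j \in js -> arith_term t -> arith (fun e => lo_dom (L j) (t e)).
  by move=> /dom_arith aL; exact: arith_app1.
have alt j t u : j \in js -> arith_term t -> arith_term u ->
    arith (fun e => lo_lt (L j) (t e) (u e)).
  by move=> /lt_arith aL; exact: arith_app2.
rewrite /separated /tuple_lt /tuple_below /tuple_in /setI /setD /column /=.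
by arith_auto; (apply: adom || apply: alt) => //; arith_auto.
Qed.

(* In a separated family, some column has no least element, since a tuple of    *)
(* least elements would have a smaller tuple in [A] outside the family; that    *)
(* column lies in its ill-founded part. The separated families containing [b]   *)
(* form a closed set, so the leftmost one is arithmetical uniformly in [b].     *)
Lemma arith_ill_part_of_separation :
  tuple_in js (ill_part \o L) `<=` A ->
  tuple_in js (wf_part \o L) `<=` ~` A ->
  exists2 j, j \in js & arith_set (ill_part (L j)).
Proof.
move=> ill_A wf_A; apply: contrapT => no_arith.
pose path (b : nat) : nat -> Prop := leftmost_path (separated b).
pose core b j := lo_dom (L j) `&` column (path b) j.
pose cores j x := exists b, no_least (L j) (core b j) /\ core b j x.
have cores_arith j : j \in js -> arith_set (cores j).
  move=> js_j; have adom := dom_arith js_j; have alt := lt_arith js_j.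
  have apath : arith (fun e => path (e 0) (e 1)).
    exact: arith_leftmost_path arith_separated.
  by rewrite /arith_set /cores /no_least /core /setI /column /=; arith_auto.
have [b ill_b] : exists b, tuple_in js (fun j => ill_part (L j) `\` cores j) b.
  apply: tuple_in_exists => j js_j; apply: contrapT => no_x; apply: no_arith.
  exists j => //; suff <- : cores j = ill_part (L j) by exact: cores_arith.
  apply/seteqP; split=> [x [b [/no_least_sub_ill_part core_ill]]|x ill_x].
    exact: core_ill.
  by apply: contrapT => not_cores_x; apply: no_x; exists x.
have sep_path n : separated b n (path b).
  apply: leftmost_path_in_tree => {n} [m n U V|n]; first exact: separated_restrict.
  by apply: separated_ill_part => // j /ill_b[].
have [j js_j core_no_least] := separated_no_least sep_path.
have [ill_j] := ill_b j js_j; apply; exists b; split=> //; split.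
  exact: ill_part_dom.
have [n lt_b] := tuple_below_exists b; have [b_in _] := sep_path n; exact: b_in.
Qed.

End Separation.

(** * Forcing *)

(* Only the part of [stem] below [stem_len] is significant. *)
Record condition : Type := Condition {
  stem : set nat;
  stem_len : nat;
  active : nat
}.

Definition admits (C : nat -> set nat) (p : condition) (D : set nat) : Prop :=
  agree (stem_len p) D (stem p) /\
  forall i, i < active p -> forall m,
    stem_len p <= pairn i m -> column D i m -> C i m.

Lemma admits_sub (C C' : nat -> set nat) p :
  (forall i, i < active p -> C i `<=` C' i) -> admits C p `<=` admits C' p.
Proof.
move=> sub D [agree_D C_D]; split=> // i lt_i m le_m Dm.
by apply: (sub i lt_i); exact: C_D.
Qed.

Section Forcing.
Variable C : nat -> set nat.
Implicit Types (p q : condition) (D : set nat).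

Definition extends q p : Prop := stem_len p <= stem_len q /\ admits C q `<=` admits C p.

Lemma extends_refl p : extends p p.
Proof. by split=> // D. Qed.

Lemma extends_trans p q r : extends r q -> extends q p -> extends r p.
Proof.
move=> [le_qr sub_rq] [le_pq sub_qp]; split; first exact: leq_trans le_pq le_qr.
by move=> D /sub_rq/sub_qp.
Qed.

Definition stem_set p : set nat := stem p `&` `I_(stem_len p).

Lemma admits_stem_set p : admits C p (stem_set p).
Proof.
split; first exact: agree_setI_ltn.
by move=> i _ m; rewrite leqNgt => /negP ge_m [_].
Qed.

Lemma extends_admitted p D n k :
  admits C p D -> stem_len p <= n -> active p <= k -> extends (Condition D n k) p.
Proof.
move=> [agree_D C_D] le_n le_k; split=> // E [/= agree_E C_E].
split=> [|i lt_i m le_m Em]; first exact: agree_trans (agreeW le_n agree_E) agree_D.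
have [lt_n|ge_n] := ltnP (pairn i m) n; last by apply: C_E => //; exact: leq_trans le_k.
by apply: C_D => //; exact/(agree_E _ lt_n).
Qed.

Lemma admits_bigcup_stem_set (P : nat -> condition) :
  (forall t, extends (P t.+1) (P t)) ->
  forall t, admits C (P t) (\bigcup_s stem_set (P s)).
Proof.
move=> P_ext t; have P_mono s r : s <= r -> extends (P r) (P s).
  elim: r => [|r IH]; first by rewrite leqn0 => /eqP ->; exact: extends_refl.
  rewrite leq_eqVlt => /predU1P[->|/IH]; first exact: extends_refl.
  exact: extends_trans.
have stem_admitted s r : s <= r -> admits C (P s) (stem_set (P r)).
  by move=> /P_mono [_ sub]; exact/sub/admits_stem_set.
split=> [a lt_a|i lt_i m le_m [s _ Ps]].
  split=> [[s _ Ps]|Pa]; last by exists t => //; split.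
  have [le_st|/ltnW le_ts] := leqP s t; last exact/((stem_admitted _ _ le_ts).1 _ lt_a).
  have [Pa lt_s] := Ps.
  by have [] := ((stem_admitted _ _ le_st).1 _ lt_s).2 Pa.
have [le_st|/ltnW le_ts] := leqP s t; last exact: (stem_admitted _ _ le_ts).2 Ps.
have [le_len _] := P_mono _ _ le_st; case: Ps => _ /= lt_s.
by move: (leq_trans lt_s (leq_trans le_len le_m)); rewrite ltnn.
Qed.

Lemma generic_exists (T : countType) (R : T -> set (set nat)) :
  (forall t p, exists q, extends q p /\ admits C q `<=` R t) ->
  exists D, forall t, R t D.
Proof.
move=> R_dense.
have /choice [next next_meets] (np : nat * condition) : exists q, extends q np.2 /\
    forall t, pickle t = np.1 -> admits C q `<=` R t.
  have [[t e]|no_t] := pselect (exists t : T, pickle t = np.1).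
    have [q [ext_q R_q]] := R_dense t np.2; exists q; split=> // t'.
    by rewrite -e => /(pcan_inj pickleK) ->.
  by exists np.2; split=> [|t e]; [exact: extends_refl | case: no_t; exists t].
pose P := fix P n := if n is m.+1 then next (m, P m) else Condition set0 0 0.
have P_ext n : extends (P n.+1) (P n) by have [] := next_meets (n, P n).
exists (\bigcup_n stem_set (P n)) => t.
have [_] := next_meets (pickle t, P (pickle t)); apply=> //.
exact: (admits_bigcup_stem_set P_ext (pickle t).+1).
Qed.

Lemma dense_column_sub i p : exists q, extends q p /\
  forall D, admits C q D -> exists N, column D i `\` `I_N `<=` C i.
Proof.
exists (Condition (stem_set p) (stem_len p) (maxn (active p) i.+1)); split.
  by apply: extends_admitted; rewrite ?leq_maxl //; exact: admits_stem_set.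
move=> D [_ /= C_D]; exists (stem_len p) => m [Dm /negP]; rewrite -leqNgt => le_m.
by apply: C_D => //; [rewrite leq_max leqnn orbT | exact: leq_trans (leq_pairn i m)].
Qed.

Lemma dense_column_mem i m p : stem_len p <= m -> C i m ->
  exists q, extends q p /\ forall D, admits C q D -> column D i m.
Proof.
move=> le_m Cm; have le_pair := leq_trans le_m (leq_pairn i m).
exists (Condition (stem_set p `|` [set pairn i m]) (pairn i m).+1 (active p)).
split; last by move=> D [agree_D _]; apply/(agree_D _ (ltnSn _)); right.
apply: extends_admitted => //; last exact: leqW.
split=> [a lt_a|j _ m' le_m' [[_ /=]|/pairn_inj[-> ->]] //].
  split=> [[[]|/= e] //|stem_a]; last by left.
  by move: lt_a; rewrite e ltnNge le_pair.
by rewrite ltnNge le_m'.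
Qed.

Definition possible_answer p c a y : Prop :=
  exists x, admits C p (bits x) /\ eval (chi (bits x)) c [:: a] y.

Lemma possible_answer_of_eval p c a y D :
  admits C p D -> eval (chi D) c [:: a] y -> possible_answer p c a y.
Proof.
move=> [agree_D C_D] eval_D; have [N useN] := eval_use eval_D.
have [x bits_x] := bits_surj D (maxn N (stem_len p)).
exists x; rewrite bits_x; split; last by apply: useN; exact/agree_setI_ltn/leq_maxl.
split=> [|i lt_i m le_m [Dm _]]; last exact: C_D.
by apply: (agree_trans _ agree_D); exact/agree_setI_ltn/leq_maxr.
Qed.

Lemma possible_answer_forced p c a y : possible_answer p c a y ->
  exists q, extends q p /\ forall D, admits C q D -> eval (chi D) c [:: a] y.
Proof.
move=> [x [adm_x eval_x]]; have [N useN] := eval_use eval_x.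
exists (Condition (bits x) (maxn N (stem_len p)) (active p)); split.
  by apply: extends_admitted; rewrite ?leq_maxr.
by move=> D [agree_D _]; apply: useN; exact: agreeW (leq_maxl _ _) agree_D.
Qed.

End Forcing.

Lemma possible_answer_sub (C C' : nat -> set nat) p c a y :
  admits C p `<=` admits C' p ->
  possible_answer C p c a y -> possible_answer C' p c a y.
Proof. by move=> sub [x [/sub adm_x eval_x]]; exists x. Qed.

Lemma dense_column_below (L : nat -> linear_order) i N p x : ill_part (L i) x ->
  exists q, extends (ill_part \o L) q p /\
    forall D, admits (ill_part \o L) q D ->
      exists m, (column D i `\` `I_N) m /\ lo_lt (L i) m x.
Proof.
move=> [g Lg <-]; have [n] := descending_unbounded (maxn (stem_len p) N) Lg.
rewrite geq_max => /andP[le_len le_N].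
have ill_g : (ill_part \o L) i (g n.+1) by exact: ill_part_descending.
have [q [ext_q q_mem]] := dense_column_mem le_len ill_g.
exists q; split=> // D /q_mem Dm; exists (g n.+1).
by split; [split=> //; apply/negP; rewrite -leqNgt | exact: descending_lt].
Qed.

Section ConeAvoidance.
Variables (X : set nat) (L : nat -> linear_order) (p : condition) (c : code).
Hypothesis X_not_arith : ~ arith_set X.
Hypothesis L_computable : forall i, computable_order (L i).

Let js : seq nat :=
  [seq i <- iota 0 (active p) | ~~ `[< arith_set (ill_part (L i)) >]].

Definition relaxed (v i : nat) : set nat :=
  if i \in js then lo_lt (L i) (entry v i) else ill_part (L i).

Lemma arith_possible_answer_relaxed :
  arith (fun e => possible_answer (relaxed (e 0)) p c (e 1) (e 2)).
Proof.
apply: arith_exists; apply: arith_and; first apply: arith_and.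
- by apply: arith_forall_ltn => a _; arith_auto.
- apply: arith_forall_ltn => i lt_i.
  have a_relaxed : arith (fun e => relaxed (e 0) i (e 1)).
    rewrite /relaxed; have [_|] := boolP (i \in js).
      by have [_ alt] := computable_order_arith (L_computable i); arith_auto.
    rewrite mem_filter mem_iota /= lt_i andbT negbK => /asboolP aL.
    exact: (arith_app1 aL (arith_var 1)).
  apply: arith_forall; apply: arith_imp; first by arith_auto.
  apply: arith_imp; first by rewrite /column /=; arith_auto.
  by apply: (arith_app2 (R := fun v m => relaxed v i m) a_relaxed); arith_auto.
- pose s e := scons (e 0) (scons (e 3) (fun=> e 2)).
  by apply: (@arith_subst _ s (arith_eval c 1)) => -[|[|i]] /=; arith_auto.
Qed.

Lemma admits_relaxed_of_wf v :
  tuple_in js (wf_part \o L) v -> admits (ill_part \o L) p `<=` admits (relaxed v) p.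
Proof.
move=> v_wf; apply: admits_sub => i _ m ill_m; rewrite /relaxed; case: ifPn => // js_i.
exact: wf_part_lt_ill_part (v_wf i js_i) ill_m.
Qed.

Lemma admits_of_relaxed_ill v :
  tuple_in js (ill_part \o L) v -> admits (relaxed v) p `<=` admits (ill_part \o L) p.
Proof.
move=> v_ill; apply: admits_sub => i _ m; rewrite /relaxed; case: ifPn => // js_i.
exact: ill_part_up (v_ill i js_i).
Qed.

Lemma dense_not_computing : exists q, extends (ill_part \o L) q p /\
  forall D, admits (ill_part \o L) q D -> ~ forall a, eval (chi D) c [:: a] (chi X a).
Proof.
pose answers v := possible_answer (relaxed v) p c.
have answers_arith : arith (fun e => answers (e 0) (e 1) (e 2)).
  exact: arith_possible_answer_relaxed.
have [[v [v_wf [a no_chi]]]|wf_possible] := pselect (exists v,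
    tuple_in js (wf_part \o L) v /\ exists a, ~ answers v a (chi X a)).
  exists p; split=> [|D adm_D D_computes]; first exact: extends_refl.
  apply: no_chi; apply: possible_answer_of_eval (D_computes a).
  exact: admits_relaxed_of_wf adm_D.
have [[v [v_ill [a [y [answers_y y_wrong]]]]]|ill_correct] := pselect (exists v,
    tuple_in js (ill_part \o L) v /\ exists a y, answers v a y /\ y <> chi X a).
  have answers_ill := possible_answer_sub (admits_of_relaxed_ill v_ill) answers_y.
  have [q [ext_q q_forces]] := possible_answer_forced answers_ill.
  exists q; split=> // D adm_D D_computes; apply: y_wrong.
  exact: eval_deterministic (q_forces D adm_D) (D_computes a).
pose consistent v := forall a y z, answers v a y -> answers v a z -> y = z.
suff [j] : exists2 j, j \in js & arith_set (ill_part (L j)).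
  by rewrite mem_filter => /andP[/asboolP].
apply: (@arith_ill_part_of_separation js L consistent) => [j _|j _||v v_ill|v v_wf].
- by have [] := computable_order_arith (L_computable j).
- by have [] := computable_order_arith (L_computable j).
- by rewrite /arith_set /consistent; arith_auto.
- have correct a w : answers v a w -> w = chi X a.
    move=> answers_w; apply: contrapT => w_wrong; apply: ill_correct.
    by exists v; split=> //; exists a, w.
  by move=> a y z /correct -> /correct ->.
- move=> v_consistent; apply: X_not_arith.
  apply: (@arith_set_of_chi_graph X (answers v)) => [|a|//]; first by arith_auto.
  by apply: contrapT => no_chi; apply: wf_possible; exists v; split=> //; exists a.
Qed.

End ConeAvoidance.

(** * Tight descending sequences *)

Lemma tight_least_descent L A f : ill_coinitial L A -> descending L f ->
  (forall n m, A m -> lo_lt L m (f n) -> f n.+1 <= m) -> tight_descending L f.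
Proof.
move=> A_coinit Lf f_least; split=> // g Lg n; apply: contrapT => f_above.
have [m [Am lt_mg]] := A_coinit _ (ill_part_descending n Lg).
have lt_mf l : lo_lt L m (f l).
  have [dom_m _] := lo_lt_dom lt_mg; have [_ dom_f] := lo_lt_dom (Lf l).
  case: (lo_lt_total dom_m dom_f) => // [e|lt_fm]; case: f_above; exists l.
    by rewrite -e.
  exact: lo_lt_trans lt_fm lt_mg.
(* As [m] is eligible at every step, the least choices never exceed it. *)
have [l] := descending_unbounded m.+1 Lf; apply/negP; rewrite -leqNgt.
exact: f_least Am (lt_mf l).
Qed.

Lemma ill_coinitial_tight_descending L A : computable_order L -> ill_founded L ->
  A `<=` ill_part L -> ill_coinitial L A ->
  exists2 f, tight_descending L f & fun_computable_in A f.
Proof.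
move=> [_ lt_comp] [g Lg] A_ill A_coinit.
pose cand z m := `[< A m >] && `[< lo_lt L m z >].
have candP z m : reflect (A m /\ lo_lt L m z) (cand z m).
  by rewrite /cand -asbool_and; exact: asboolP.
have /choice [next nextP] z : exists m, ill_part L z ->
    cand z m /\ forall m', cand z m' -> m <= m'.
  have [/A_coinit ex|] := pselect (ill_part L z); last by exists 0.
  have {}ex : exists m, cand z m by case: ex => m /candP; exists m.
  by case: (ex_minnP ex) => m cand_m m_min; exists m.
pose f n := iter n next (g 0).
have ill_f n : ill_part L (f n).
  elim: n => [|n /nextP[/candP[/A_ill]]] //=; exact: ill_part_descending.
have Lf n : cand (f n) (f n.+1) by have [] := nextP _ (ill_f n).
have f_least n m : cand (f n) m -> f n.+1 <= m by have [_] := nextP _ (ill_f n); exact.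
exists f.
  apply: (tight_least_descent A_coinit) => [n|n m Am lt_m].
    by case: (candP _ _ (Lf n)).
  exact/f_least/candP.
apply: fun_computable_least_search Lf f_least; apply: computes_andb.
  exact: computes_oracle.
apply: (@computes2 _ _ (fun y x => `[< lo_lt L y x >])) => //.
exact: computes_trans (set0_turing_le A).
Qed.

Lemma column_setD_turing_le D i N : turing_le (column D i `\` `I_N) D.
Proof.
have cN : computes (chi D) 1 (fun v => N <= nth 0 v 0) by exact: computes_leq.
have cD : computes (chi D) 1 (fun v => chi D (pairn i (nth 0 v 0))).
  by apply/computes_oracle/computes_pairn.
apply/fun_computableP; apply: eq_computes (computes_andb cD cN) => v _.
by rewrite /chi /setD /mkset asbool_and asbool_neg asboolb -leqNgt.
Qed.

Definition empty_order : linear_order :=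
  @LinearOrder set0 (fun _ _ => False) (fun _ _ => @False_ind _) (fun _ => id)
    (fun _ _ _ lt_xy _ => lt_xy) (fun _ _ dom_x _ => False_ind _ dom_x).

Lemma computable_empty_order : computable_order empty_order.
Proof.
split; first by apply: eq_computes (computes_const _ _ 0) => v _; rewrite asboolF.
by apply: eq_computes (computes_const _ _ 0) => v _; rewrite asboolF.
Qed.

Lemma computable_orders_enumerable : exists Ls : nat -> linear_order,
  (forall i, computable_order (Ls i)) /\
  forall L, computable_order L -> exists i, lo_lt (Ls i) = lo_lt L.
Proof.
pose has_code i L := exists2 c, pickle c = i & forall v, size v = 2 ->
  eval (chi set0) c v `[< lo_lt L (nth 0 v 0) (nth 0 v 1) >].
have /choice [Ls LsP] i : exists L, computable_order L /\
    ((exists2 L', computable_order L' & has_code i L') -> has_code i L).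
  have [[L cL codeL]|no_L] := pselect (exists2 L, computable_order L & has_code i L).
    by exists L.
  by exists empty_order; split=> //; exact: computable_empty_order.
exists Ls; split=> [i|L cL]; first by have [] := LsP i.
have [_ [c eval_c]] := cL; exists (pickle c).
have [_ []] := LsP (pickle c); first by exists L => //; exists c.
move=> c' /(pcan_inj pickleK) -> eval_c'.
apply/funext => x; apply/funext => y; apply/propext.
have := eval_deterministic (eval_c [:: x; y] erefl) (eval_c' [:: x; y] erefl).
by case: asboolP => lt_xy; case: asboolP => lt_xy' //; split.
Qed.

Lemma generic_columns (X : set nat) (Ls : nat -> linear_order) :
  ~ arith_set X -> (forall i, computable_order (Ls i)) ->
  exists D, [/\ ~ turing_le X D,
    forall i, exists N, column D i `\` `I_N `<=` ill_part (Ls i) &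
    forall i N, ill_coinitial (Ls i) (column D i `\` `I_N)].
Proof.
move=> X_not_arith Ls_computable; pose ill := ill_part \o Ls.
pose meets (r : code + nat + nat * nat * nat) : set (set nat) :=
  match r with
  | inl (inl c) => [set D | ~ forall a, eval (chi D) c [:: a] (chi X a)]
  | inl (inr i) => [set D | exists N, column D i `\` `I_N `<=` ill i]
  | inr (i, N, x) => [set D | ill i x ->
      exists m, (column D i `\` `I_N) m /\ lo_lt (Ls i) m x]
  end.
have [|D D_meets] := @generic_exists ill _ meets.
  move=> [[c|i]|[[i N] x]] p.
  - exact: dense_not_computing.
  - exact: dense_column_sub.
  - have [ill_x|not_ill] := pselect (ill i x).
      have [q [ext_q q_meets]] := dense_column_below N p ill_x.
      by exists q; split=> // D /q_meets D_below _.
    by exists p; split=> [|D _ /not_ill //]; exact: extends_refl.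
exists D; split=> [[c D_computes]|i|i N x]; first exact: (D_meets (inl (inl c))).
- exact: (D_meets (inl (inr i))).
- exact: (D_meets (inr (i, N, x))).
Qed.

Definition degree_of (A : set nat) : turing_degree :=
  @TuringDegree (turing_equiv^~ A) (ex_intro _ A (fun=> iff_refl _)).

Lemma degree_of_mem A : degree_sets (degree_of A) A.
Proof. by split; exact: turing_le_refl. Qed.

Lemma degree_of_computes_set A X : degree_computes_set (degree_of A) X -> turing_le X A.
Proof. by move=> [B [leBA _] leXB]; exact: turing_le_trans leXB leBA. Qed.

Theorem mainTheorem12 (X : set nat) (HX : ~ arithmetical X) :
  exists d : turing_degree,
    high_for_tight_descending d /\ ~ degree_computes_set d X.
Proof.
have [Ls [cLs Ls_enum]] := computable_orders_enumerable.
have nX : ~ arith_set X by move/arith_set_arithmetical.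
have [D [nXD D_ill D_coinit]] := generic_columns nX cLs.
exists (degree_of D); split; last by move/degree_of_computes_set.
move=> L cL [g Lg]; have [i e] := Ls_enum L cL; have [N DN_ill] := D_ill i.
have ill_Ls : ill_founded (Ls i) by exists g => n; rewrite e; exact: Lg.
have [f tight_f comp_f] :=
  ill_coinitial_tight_descending (cLs i) ill_Ls DN_ill (D_coinit i N).
exists f; first by move: tight_f; rewrite /tight_descending /descending e.
exists D; first exact: degree_of_mem.
exact: fun_computable_trans comp_f (column_setD_turing_le D i N).
Qed.
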